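(* Let $\mathbb{F}_q$ be a finite field of any characteristic, let $\mathcal{F}=\mathbb{F}_q(x,y)$ be a cubic function field extension of $\mathbb{F}_q(x)$ given in standard form by $y^3-Ay+B=0$ with $A,B\in\mathbb{F}_q[x]$, and let $h$ be the class number of $\mathcal{F}$. Let $p\in\mathbb{N}$ be a prime with $p\mid h$. Then there is an $\alpha\in\mathcal{O}$ which is not a $p$-th power in $\mathcal{F}$ such that $N_{\mathcal{F}|\mathbb{F}_q(x)}(\alpha)$ is, up to a constant factor in $\mathbb{F}_q^*$, a $p$-th power in $\mathbb{F}_q[x]$.
   Context: Standard form: $x$ is transcendental over $\mathbb{F}_q$, $T^3-A(x)T+B(x)\in\mathbb{F}_q[x][T]$ is irreducible over $\mathbb{F}_q(x)$ with root $y$, at least one of $A,B$ is non-constant, there is no non-constant $Q\in\mathbb{F}_q[x]$ with $Q^2\mid A$ and $Q^3\mid B$, and $\mathbb{F}_q$ is algebraically closed in $\mathcal{F}$. $\mathcal{O}$ is the integral closure of $\mathbb{F}_q[x]$ in $\mathcal{F}$. The norm $N_{\mathcal{F}|\mathbb{F}_q(x)}(\alpha)$ is the determinant of multiplication by $\alpha$ on the $\mathbb{F}_q(x)$-vector space $\mathcal{F}$. The class number $h$ is the order of the group of degree-$0$ divisors of $\mathcal{F}$ modulo principal divisors. *)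

(* Defs.v *)
From HB Require Import structures.
From mathcomp Require Import all_boot all_order all_algebra all_field.
From mathcomp Require Import boolp classical_sets functions cardinality fsbigop.

Set Implicit Arguments.
Unset Strict Implicit.
Unset Printing Implicit Defensive.

Import Order.TTheory GRing.Theory Num.Theory.

Local Open Scope classical_set_scope.
Local Open Scope ring_scope.

(* The rational function field F_q(x) is {fraction {poly F}}, with x = 'X%:F. *)
Notation ratfun F := {fraction {poly F}}.

Notation "p %:F" := (@FracField.tofrac _ p) : ring_scope.

Section FunctionField.

Variables (F : finFieldType) (L : fieldExtType (ratfun F)).

Definition poly_in (f : {poly F}) : L := (f%:F)%:A.

Definition const_in (c : F) : L := poly_in c%:P.

Record standard_form (A B : {poly F}) (y : L) : Prop := StandardForm {
  sf_irreducible :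
    irreducible_poly ('X^3 - (A%:F)%:P * 'X + (B%:F)%:P : {poly ratfun F});
  sf_root : y ^+ 3 - poly_in A * y + poly_in B = 0;
  sf_generator : <<1; y>>%VS = fullv;
  sf_nonconstant : (1 < size A)%N \/ (1 < size B)%N;
  sf_minimal : forall Q : {poly F},
    (1 < size Q)%N -> ~ (Q ^+ 2 %| A /\ Q ^+ 3 %| B);
  sf_constants : forall z : L,
    algebraicOver const_in z -> exists c : F, z = const_in c }.

Definition integral_closure : set L := [set z | integralOver poly_in z].

Definition field_norm (a : L) : ratfun F :=
  \det (passmx.mxof (vbasis {:L}) (vbasis {:L}) (amull a)).

(* A place is given by its normalized discrete valuation, trivial on F_q.     *)
(* The value +oo of the valuation at 0 is replaced by the dummy value 0, so   *)
(* that distinct elements of [place] are distinct places; every use of        *)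
(* [ord P a] below treats a = 0 separately.                                   *)
Record place := Place {
  ord :> L -> int;
  ord0 : ord 0 = 0;
  ordM : forall a b, a != 0 -> b != 0 -> ord (a * b) = ord a + ord b;
  ordD : forall a b, a != 0 -> b != 0 -> a + b != 0 ->
    Num.min (ord a) (ord b) <= ord (a + b);
  ord_const : forall c, c != 0 -> ord (const_in c) = 0;
  ord_surj : forall n, exists2 a, a != 0 & ord a = n }.

HB.instance Definition _ := gen_eqMixin place.
HB.instance Definition _ := gen_choiceMixin place.

Definition valuation_ring (P : place) : set L := [set a | a = 0 \/ 0 <= P a].

Definition maximal_ideal (P : place) : set L := [set a | a = 0 \/ 0 < P a].

(* b lifts an F_q-basis of valuation_ring P / maximal_ideal P. *)
Definition residue_basis (P : place) (n : nat) (b : 'I_n -> L) : Prop :=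
  (forall i, valuation_ring P (b i)) /\
  (forall z, valuation_ring P z -> exists! c : {ffun 'I_n -> F},
     maximal_ideal P (z - \sum_(i < n) const_in (c i) * b i)).

(* The dimension of the residue field over F_q, which is always finite. *)
Definition place_degree (P : place) : nat :=
  xget 0%N [set n | exists b : 'I_n -> L, residue_basis P b].

Definition is_divisor (D : place -> int) : Prop :=
  finite_set [set P | D P != 0].

Definition divisor_degree (D : place -> int) : int :=
  \sum_(P \in [set: place]) D P * (place_degree P)%:Z.

Definition is_principal (D : place -> int) : Prop :=
  exists2 a : L, a != 0 & forall P : place, D P = ord P a.

Definition divisors0 : set (place -> int) :=
  [set D | is_divisor D /\ divisor_degree D = 0].

Definition divisor_class (D : place -> int) : set (place -> int) :=
  [set E | divisors0 E /\ is_principal (E \- D)].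

Definition class_group0 : set (set (place -> int)) :=
  [set divisor_class D | D in divisors0].

Definition is_class_number (h : nat) : Prop := (class_group0 #= `I_h)%card.

End FunctionField.

(* Main.v *)
Require Import Defs.
From HB Require Import structures.
From mathcomp Require Import all_boot all_order all_algebra all_fingroup all_solvable all_field.
From mathcomp Require Import boolp classical_sets functions cardinality fsbigop.
From mathcomp Require Import zify ring.

(** Since [p] divides the order of the class group, Cauchy's theorem gives a
    divisor [D] which is not principal although [p D] is the divisor of some [a]
    ([cauchy_quotient], [exists_torsion_divisor]). Multiplying [a] by the [p]-th
    power of a polynomial makes it integral. It is not a [p]-th power: if it
    were the [p]-th power of [b], then [D] would be the divisor of [b], up to the
    divisor of a polynomial. It remains to see that its norm is a constant times
    a [p]-th power.

    By unique factorization ([ratfun_polynomial], [polynomial_power]) it is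
    enough that the [Q]-adic value of the norm is divisible by [p] for every
    irreducible polynomial [Q] and nonnegative. This is a statement about any
    finite extension [L] of a field [K] with a normalized discrete valuation
    [v], [dvd_val_norm]: if [p] divides the value of [a] at all the discrete
    valuations of [L] above [v], then it divides the value of the norm at [v].
    Indeed, there are finitely many valuations above [v] ([size_above]), so weak
    approximation ([approximation]) provides [b] such that [u = a / b ^ p] has
    value zero at all of them. An element with no pole above [v] has a norm with
    no pole at [v] ([norm_ge0]); applied to [u] and [u^-1], this shows that the
    norm of [u] is a unit at [v], and the norm of [a] is that of [u] times the
    [p]-th power of that of [b].

    For [norm_ge0], an element [u] that is not integral over the valuation ring
    of [v] has a pole above [v]: Chevalley's argument
    ([exists_valuation_subring]) gives a valuation ring of [L] that contains
    [u^-1] but not [u], and it is discrete because [L] is finite over [K]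
    ([power_commensurable], [valuation_of_subring]). An element that is integral
    has an integral norm since the matrices of all its powers have a common
    denominator ([norm_integral]). *)

Set Implicit Arguments.
Unset Strict Implicit.
Unset Printing Implicit Defensive.

Import Order.TTheory GRing.Theory Num.Theory.
Local Open Scope ring_scope.

(** * Discrete valuations *)

Ltac intros_lia := intros; lia.

Lemma mulz_eq1_ge0 (x y : int) : x * y = 1 -> 0 <= y -> y = 1.
Proof.
move=> e y0; have : absz (x * y) = 1%N by rewrite e.
by rewrite abszM => /eqP; rewrite muln_eq1 => /andP[_ /eqP]; lia.
Qed.

(** The value at [0], morally infinite, is pinned to [0] so that a valuation is
    determined by its values at nonzero elements, as for places. *)
Record normalized_valuation (E : fieldType) (v : E -> int) : Prop := {
  valuation0 : v 0 = 0;
  valuationM : forall a b : E, a != 0 -> b != 0 -> v (a * b) = v a + v b;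
  valuationD : forall a b : E, a != 0 -> b != 0 -> a + b != 0 ->
    Num.min (v a) (v b) <= v (a + b);
  valuation_surj : forall n, exists2 a : E, a != 0 & v a = n }.

Section ValuationTheory.

Variables (E : fieldType) (v : E -> int).
Hypothesis hv : normalized_valuation v.

Lemma valuation1 : v 1 = 0.
Proof.
by apply: (addrI (v 1)); rewrite -(valuationM hv) ?oner_neq0 // mulr1 addr0.
Qed.

Lemma valuationV a : v a^-1 = - v a.
Proof.
have [->|a0] := eqVneq a 0; first by rewrite invr0 (valuation0 hv).
have a0' : a^-1 != 0 by rewrite invr_eq0.
by have := valuationM hv a0 a0'; rewrite divff // valuation1; intros_lia.
Qed.

Lemma valuationX a n : v (a ^+ n) = n%:Z * v a.
Proof.
have [->|a0] := eqVneq a 0.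
  by case: n => [|n]; rewrite ?expr0 ?valuation1 ?mul0r // expr0n (valuation0 hv) mulr0.
elim: n => [|n IH]; first by rewrite expr0 valuation1 mul0r.
by rewrite exprS (valuationM hv) ?expf_neq0 // IH; intros_lia.
Qed.

Lemma valuationXz a (m : int) : v (a ^ m) = m * v a.
Proof.
by case: m => n; rewrite ?NegzE -?exprnN ?valuationV -?exprnP valuationX //; intros_lia.
Qed.

Lemma valuationN a : v (- a) = v a.
Proof.
have [->|a0] := eqVneq a 0; first by rewrite oppr0.
have n1 : (-1 : E) != 0 by rewrite oppr_eq0 oner_neq0.
have := valuationM hv n1 n1; rewrite mulrNN mulr1 valuation1 -(mulN1r a) (valuationM hv n1 a0); intros_lia.
Qed.

Lemma valuationD_lt a b : a != 0 -> b != 0 -> v a < v b ->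
  a + b != 0 /\ v (a + b) = v a.
Proof.
move=> a0 b0 lt; have ab0 : a + b != 0.
  by apply/eqP => /eqP; rewrite addr_eq0 => /eqP e; move: lt; rewrite e valuationN; intros_lia.
split=> //; have := valuationD hv a0 b0 ab0.
have := valuationD hv ab0 (_ : - b != 0); rewrite oppr_eq0 addrK valuationN => /(_ b0 a0).
by move: (v (a + b)) => c; intros_lia.
Qed.

(** Comparison with the value [+oo] at [0] restored, which makes the bound
    stable under sums without side conditions. *)
Definition val_ge (n : int) (a : E) := (a == 0) || (n <= v a).

Lemma val_ge0 n : val_ge n 0. Proof. by rewrite /val_ge eqxx. Qed.

Lemma val_geE n a : a != 0 -> val_ge n a = (n <= v a).
Proof. by rewrite /val_ge => /negbTE ->. Qed.

Lemma val_geD n a b : val_ge n a -> val_ge n b -> val_ge n (a + b).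
Proof.
rewrite /val_ge; have [->|a0] := eqVneq a 0; first by rewrite add0r.
have [->|b0] := eqVneq b 0; first by rewrite addr0 (negbTE a0).
have [->//|ab0] /= := eqVneq (a + b) 0.
by move=> na nb; apply: le_trans (valuationD hv a0 b0 ab0); intros_lia.
Qed.

Lemma val_geM n m a b : val_ge n a -> val_ge m b -> val_ge (n + m) (a * b).
Proof.
rewrite /val_ge mulf_eq0; have [//|a0] := eqVneq a 0.
by have [//|b0] /= := eqVneq b 0; rewrite (valuationM hv) //; intros_lia.
Qed.

Lemma val_geN n a : val_ge n (- a) = val_ge n a.
Proof. by rewrite /val_ge oppr_eq0 valuationN. Qed.

Lemma val_ge1 : val_ge 0 1. Proof. by rewrite /val_ge valuation1 lexx orbT. Qed.

Lemma val_ge_sum I (r : seq I) (P : pred I) (f : I -> E) n :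
  (forall i, P i -> val_ge n (f i)) -> val_ge n (\sum_(i <- r | P i) f i).
Proof. by move=> H; elim/big_ind: _ => //; [exact: val_ge0 | exact: val_geD]. Qed.

Lemma val_ge_prod n (k : nat) (f : 'I_k -> E) :
  (forall i, val_ge n (f i)) -> val_ge (n * k%:Z) (\prod_(i < k) f i).
Proof.
elim: k f => [|k IH] f H; first by rewrite big_ord0 mulr0 val_ge1.
rewrite big_ord_recr; have -> : n * k.+1%:Z = n * k%:Z + n by intros_lia.
by apply: val_geM => //; exact: IH.
Qed.

Lemma val_ge_det n (k : nat) (M : 'M[E]_k) :
  (forall i j, val_ge n (M i j)) -> val_ge (n * k%:Z) (\det M).
Proof.
move=> H; apply: val_ge_sum => s _.
rewrite -[n * _]add0r; apply: val_geM; last by apply: val_ge_prod => i.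
by rewrite /val_ge signr_eq0 /= valuationX valuationN valuation1 mulr0.
Qed.

End ValuationTheory.

(** * Valuation rings *)

Record subring (E : fieldType) (A : set E) : Prop := {
  subring1 : A 1;
  subringB : forall a b, A a -> A b -> A (a - b);
  subringM : forall a b, A a -> A b -> A (a * b) }.

Definition valuation_subring (E : fieldType) (A : set E) : Prop :=
  subring A /\ forall z : E, z != 0 -> A z \/ A z^-1.

Definition unit_in (E : fieldType) (A : set E) (z : E) : Prop :=
  [/\ z != 0, A z & A z^-1].

Section Subring.

Variables (E : fieldType) (A : set E).
Hypothesis hA : subring A.

Lemma subring0 : A 0.
Proof. by rewrite -(subrr 1); apply: (subringB hA); exact: (subring1 hA). Qed.

Lemma subringN a : A a -> A (- a).
Proof. by move=> Aa; rewrite -sub0r; apply: (subringB hA) => //; exact: subring0. Qed.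

Lemma subringD a b : A a -> A b -> A (a + b).
Proof. by move=> Aa Ab; rewrite -[b]opprK; apply: (subringB hA) => //; exact: subringN. Qed.

Lemma subringX a n : A a -> A (a ^+ n).
Proof.
move=> Aa; elim: n => [|n IH]; first by rewrite expr0; exact: (subring1 hA).
by rewrite exprS; apply: (subringM hA).
Qed.

Lemma subring_sum I (r : seq I) (P : pred I) (f : I -> E) :
  (forall i, P i -> A (f i)) -> A (\sum_(i <- r | P i) f i).
Proof. by move=> H; elim/big_ind: _ => //; [exact: subring0 | exact: subringD]. Qed.

Lemma unit_inM a b : unit_in A a -> unit_in A b -> unit_in A (a * b).
Proof.
move=> [a0 Aa Aa'] [b0 Ab Ab']; split; rewrite ?mulf_neq0 //.
  exact: (subringM hA).
by rewrite invfM; apply: (subringM hA).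
Qed.

Lemma unit_inV a : unit_in A a -> unit_in A a^-1.
Proof. by case=> a0 Aa Aa'; split; rewrite ?invr_eq0 ?invrK. Qed.

Lemma unit_inX a n : unit_in A a -> unit_in A (a ^+ n).
Proof.
move=> [a0 Aa Aa']; split; rewrite ?expf_neq0 // -?exprVn; exact: subringX.
Qed.

Lemma subring_expz T (m : int) : A T -> 0 <= m -> A (T ^ m).
Proof. by case: m => // n AT _; rewrite -exprnP; exact: subringX. Qed.

(** A negative power of a nonunit cannot lie in the ring: multiplying it by
    powers of [T] would give [T^-1]. *)
Lemma subring_expz_ge0 T (m : int) : T != 0 -> A T -> ~ A T^-1 ->
  A (T ^ m) -> 0 <= m.
Proof.
move=> T0 AT nT ATm; rewrite leNgt; apply/negP => m0; apply: nT.
have -> : T^-1 = T ^ m * T ^ (- 1 - m).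
  by rewrite -expfzDr // (_ : m + (-1 - m) = -1) ?exprN1 //; lia.
by apply: (subringM hA) => //; apply: subring_expz => //; lia.
Qed.

End Subring.

(** The value of [z] is read off from the relation [z ^ N ~ T ^ m]; dividing
    the resulting homomorphism by the positive generator of its image makes it
    surjective. *)
Lemma valuation_of_subring (E : fieldType) (A : set E) (T : E) (N : nat) :
  valuation_subring A -> (0 < N)%N -> T != 0 -> A T -> ~ A T^-1 ->
  (forall z : E, z != 0 -> exists m : int, unit_in A (z ^+ N / T ^ m)) ->
  exists w : E -> int, normalized_valuation w /\
    forall a : E, a != 0 -> (0 <= w a <-> A a).
Proof.
move=> [hA vA] N0 T0 AT nT /[dup] ex.
have {}ex (z : E) : exists m : int, z != 0 -> unit_in A (z ^+ N / T ^ m).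
  by have [->|/ex[m]] := eqVneq z 0; [exists 0 | exists m].
have [W hW] := choice ex => {}ex.
have Tz m : T ^ m != 0 by rewrite expfz_neq0.
have Wuniq z m : z != 0 -> unit_in A (z ^+ N / T ^ m) -> W z = m.
  move=> z0 u; have u' := hW z z0.
  have [_ A1 A2] := unit_inM hA (unit_inV u) u'.
  have e : (z ^+ N / T ^ m)^-1 * (z ^+ N / T ^ W z) = T ^ (m - W z).
    rewrite invfM invrK mulrACA mulVf ?expf_neq0 // mul1r.
    by rewrite invr_expz expfzDr.
  rewrite e in A1 A2; rewrite invr_expz opprB in A2.
  have := subring_expz_ge0 hA T0 AT nT A1; have := subring_expz_ge0 hA T0 AT nT A2; lia.
have WM a b : a != 0 -> b != 0 -> W (a * b) = W a + W b.
  move=> a0 b0; apply: Wuniq; first by rewrite mulf_neq0.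
  rewrite exprMn expfzDr // invfM mulrACA.
  by apply: unit_inM => //; exact: hW.
have W1 : W 1 = 0.
  by apply: Wuniq; rewrite ?oner_eq0 // expr1n expr0z divr1; split;
    rewrite ?oner_eq0 ?invr1 //; exact: (subring1 hA).
have WV a : a != 0 -> W a^-1 = - W a.
  move=> a0; have := WM _ _ a0 (_ : a^-1 != 0); rewrite invr_eq0 divff // W1.
  by move=> /(_ a0) e; lia.
have WXn a n : a != 0 -> W (a ^+ n) = n%:Z * W a.
  move=> a0; elim: n => [|n IH]; first by rewrite expr0 W1 mul0r.
  by rewrite exprS WM ?expf_neq0 // IH; lia.
have WX a (n : int) : a != 0 -> W (a ^ n) = n * W a.
  move=> a0; case: n => n; rewrite ?NegzE -?exprnN -?exprnP ?WV ?expf_neq0 //.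
    by rewrite WXn.
  by rewrite WXn //; lia.
have AW a : a != 0 -> A a -> 0 <= W a.
  move=> a0 Aa; apply: (subring_expz_ge0 hA T0 AT nT).
  have [_ _ A2] := hW a a0.
  have -> : T ^ W a = a ^+ N * (a ^+ N / T ^ W a)^-1.
    by rewrite invfM invrK mulrA divff ?expf_neq0 ?mul1r.
  by apply: (subringM hA) => //; exact: subringX.
have WA a : a != 0 -> 0 <= W a -> A a.
  move=> a0 Wa; have [//|Aa'] := vA a a0.
  have Wa0 : W a = 0.
    by have := AW _ (_ : a^-1 != 0) Aa'; rewrite invr_eq0 WV // => /(_ a0); lia.
  have [_ + _] := hW a a0; rewrite Wa0 expr0z divr1 => AaN.
  have -> : a = a ^+ N * a^-1 ^+ N.-1.
    by rewrite -[X in a ^+ X * _](prednK N0) exprS -mulrA -exprMn divff // expr1n mulr1.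
  by apply: (subringM hA) => //; exact: subringX.
have WD a b : a != 0 -> b != 0 -> a + b != 0 -> Num.min (W a) (W b) <= W (a + b).
  wlog ab : a b / W a <= W b.
    move=> H a0 b0 ab0; have /orP[ab|ba] := le_total (W a) (W b).
      exact: H.
    by rewrite addrC minC; apply: H => //; rewrite addrC.
  move=> a0 b0 ab0; rewrite (min_idPl ab).
  have e : a + b = a * (1 + b / a) by rewrite mulrDr mulr1 mulrCA divff ?mulr1.
  have e0 : 1 + b / a != 0 by apply: contraNneq ab0 => e0; rewrite e e0 mulr0.
  rewrite e WM //; suff : 0 <= W (1 + b / a) by lia.
  apply: AW => //; apply: (subringD hA) (subring1 hA) _; apply: WA.
    by rewrite mulf_neq0 ?invr_eq0.
  by rewrite WM ?WV ?invr_eq0 //; lia.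
have WT : W T = N.
  by apply: Wuniq => //; rewrite -exprnP divff ?expf_neq0 //; split;
    rewrite ?oner_eq0 ?invr1 //; exact: (subring1 hA).
pose Q (k : nat) := `[< (0 < k)%N /\ exists2 z : E, z != 0 & W z = k >].
have exQ : exists k, Q k by exists N; apply/asboolP; split => //; exists T.
case: (ex_minnP exQ) => d /asboolP [d0 [t t0 Wt]] dmin.
have dvd z : z != 0 -> W z = (W z %/ d)%Z * d.
  move=> z0; have := divz_eq (W z) d; set q := (_ %/ _)%Z; set r := (_ %% _)%Z.
  have rge : 0 <= r by rewrite modz_ge0; lia.
  have rlt : r < d by rewrite -[X in _ < X]/(`|d%:Z|) ltz_mod; lia.
  move=> e; have [r0|rn] := eqVneq r 0; first lia.
  have tq : t ^ (- q) != 0 by rewrite expfz_neq0.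
  have : Q `|r|%N.
    apply/asboolP; split; first lia.
    by exists (z * t ^ (- q)); rewrite ?mulf_neq0 // WM // WX // Wt; lia.
  by move/dmin; lia.
pose w z := if z == 0 then 0 else (W z %/ d)%Z.
have wW z : z != 0 -> W z = w z * d by move=> z0; rewrite /w (negbTE z0); exact: dvd.
have dpos : 0 < d%:Z by lia.
exists w; split; first split.
- by rewrite /w eqxx.
- move=> a b a0 b0; have := WM a b a0 b0; rewrite !wW ?mulf_neq0 //.
  by rewrite -mulrDl => /mulIf; apply; lia.
- move=> a b a0 b0 ab0; have := WD a b a0 b0 ab0; rewrite !wW //.
  by rewrite -minr_pMl ?ler_pM2r // ltW.
- move=> n; exists (t ^ n); first by rewrite expfz_neq0.
  have := WX t n t0; rewrite Wt wW ?expfz_neq0 // => /mulIf; apply; lia.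
move=> a a0; have := wW a a0 => e; split.
  by move=> wa; apply: WA => //; rewrite e mulr_ge0 // ltW.
by move=> /(AW _ a0); rewrite e pmulr_lge0.
Qed.

Section Chevalley.

Variable E : fieldType.

Definition adjoin (A : set E) (z : E) : set E :=
  [set x | exists2 p : {poly E}, forall i, A p`_i & x = p.[z]]%classic.

Lemma adjoin_subring A z : subring A -> subring (adjoin A z).
Proof.
move=> hA; split.
- exists 1; last by rewrite hornerE.
  by move=> i; rewrite coef1; case: (i == _); [exact: (subring1 hA) | exact: subring0].
- move=> _ _ [p hp ->] [q hq ->]; exists (p - q); last by rewrite !hornerE.
  by move=> i; rewrite coefB; exact: (subringB hA).
- move=> _ _ [p hp ->] [q hq ->]; exists (p * q); last by rewrite hornerM.
  by move=> i; rewrite coefM; apply: subring_sum => // j _; exact: (subringM hA).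
Qed.

Lemma sub_adjoin A z a : subring A -> A a -> adjoin A z a.
Proof.
move=> hA Aa; exists a%:P; last by rewrite hornerC.
by move=> i; rewrite coefC; case: (i == _) => //; exact: subring0.
Qed.

Lemma mem_adjoin A z : subring A -> adjoin A z z.
Proof.
move=> hA; exists 'X; last by rewrite hornerX.
by move=> i; rewrite coefX; case: (i == _); [exact: (subring1 hA) | exact: subring0].
Qed.

(** Chevalley's argument: take a subring [A] maximal among those that contain
    [A0] but not [u]. If neither [z] nor [z^-1] is in [A], then by maximality
    [u] is a polynomial in each of them over [A]. As [1 + u^-1 * a] is a unit
    of [A], the shorter of the two expressions can be used to lower the degree
    of the longer one, until [u] itself lands in [A]. *)
Lemma exists_valuation_subring (A0 : set E) (u : E) :
  subring A0 -> u != 0 -> A0 u^-1 -> ~ A0 u ->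
  exists A, [/\ valuation_subring A, (forall a, A0 a -> A a) & ~ A u].
Proof.
move=> hA0 u0 A0w A0u.
pose good (A : set E) := [/\ subring A, (forall a, A0 a -> A a) & ~ A u].
have [|A [gA maxA]] := @Zorn_bigcup E
    (* the empty set is included so that the empty chain has a union *)
    ([set A | A = set0 \/ good A]%classic).
  move=> C CP tot.
  have [[B [CB gB]]|none] := pselect (exists B, C B /\ good B); last first.
    left; apply/seteqP; split => x //= [B CB Bx].
    have [e|gB] := CP B CB; first by rewrite e in Bx.
    by case: none; exists B.
  have CP' X x : C X -> X x -> good X.
    by move=> CX Xx; have [e|//] := CP X CX; rewrite e in Xx.
  have dir x y : (\bigcup_(X in C) X)%classic x -> (\bigcup_(X in C) X)%classic y ->
    exists X, [/\ C X, good X, X x & X y].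
    move=> [X CX Xx] [Y CY Yy].
    by have [/(_ _ Xx) Yx|/(_ _ Yy) Xy] := tot X Y CX CY; [exists Y|exists X];
      split => //; apply: CP'; eassumption.
  (* a chain with a good member has a good union *)
  right; split; last by move=> [X CX Xu]; have [_ _] := CP' X u CX Xu; exact.
    split.
    - by exists B => //; have [hB _ _] := gB; exact: (subring1 hB).
    - move=> a b Ca Cb; have [X [CX [hX _ _] Xa Xb]] := dir a b Ca Cb.
      by exists X => //; exact: (subringB hX).
    - move=> a b Ca Cb; have [X [CX [hX _ _] Xa Xb]] := dir a b Ca Cb.
      by exists X => //; exact: (subringM hX).
  by move=> a A0a; exists B => //; have [_ A0B _] := gB; exact: A0B.
have {gA} [hA A0A Au] : good A.
  case: gA => [A0'|//]; exfalso; apply: (maxA A0); last by right; split.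
  by rewrite A0'; split => // /(_ 1 (subring1 hA0)).
have Aw := A0A _ A0w.
have adj z : ~ A z -> adjoin A z u.
  move=> Az; apply: contrapT => nu; apply: (maxA (adjoin A z)); last first.
    right; split => //; first exact: adjoin_subring.
    by move=> a /A0A; exact: sub_adjoin.
  split; first by move=> a; exact: sub_adjoin.
  by move=> /(_ z (mem_adjoin z hA)).
(* otherwise [u] would be a polynomial in [s^-1], and as [s ^ n] is [1] modulo
   [u^-1 A], clearing denominators would give [u] in [A] *)
have unitA a : A a -> 1 + u^-1 * a != 0 /\ A (1 + u^-1 * a)^-1.
  move=> Aa; set s := 1 + _; have s0 : s != 0.
    rewrite addr_eq0; apply/eqP => e; apply: Au.
    by rewrite -[u]mulr1 e mulrN mulrA divff // mul1r; exact: subringN.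
  split=> //; apply: contrapT => /adj [p hp e].
  have As : A s by apply: (subringD hA) (subring1 hA) _; exact: (subringM hA).
  have [b Ab sb] : exists2 b, A b & s ^+ size p = 1 + u^-1 * b.
    elim: (size p) => [|n [b Ab IH]].
      by exists 0; [exact: subring0 | rewrite mulr0 addr0 expr0].
    exists (b + a * s ^+ n).
      by apply: (subringD hA) => //; apply: (subringM hA) => //; exact: subringX.
    rewrite exprS {1}/s mulrDl mul1r {1}IH mulrDr addrA mulrA //.
  apply: Au; have -> : u = u * s ^+ size p - b.
    by rewrite sb mulrDr mulr1 mulrA divff // mul1r addrK.
  apply: (subringB hA) => //; rewrite e horner_coef big_distrl /=.
  apply: (subring_sum hA) => i _; rewrite -mulrA; apply: (subringM hA) => //.
  rewrite exprVn -[X in _ * s ^+ X](subnK (ltnW (ltn_ord i))) exprD mulrCA mulVf ?expf_neq0 //.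
  by rewrite mulr1; exact: subringX.
pose rep z n := exists2 a : nat -> E, forall i, A (a i) &
  u = \sum_(i < n.+1) a i * z ^+ i.
have adj_rep z : ~ A z -> exists n, rep z n.
  move=> /adj [p hp e]; exists (size p); exists (nth 0 p) => //.
  rewrite big_ord_recr /= (nth_default _ (leqnn _)) mul0r addr0 e.
  by rewrite horner_coef.
have rep0 z : ~ rep z 0%N.
  by move=> [a Aa e]; apply: Au; rewrite e big_ord1 expr0 mulr1.
have red z n m : z != 0 -> (m <= n)%N -> rep z n.+1 -> rep z^-1 m.+1 -> rep z n.
  move=> z0 mn [a Aa ea] [b Ab eb].
  have [s0 As] := unitA (- b 0%N) (subringN hA (Ab 0%N)).
  set s := 1 + _ in s0 As.
  (* [z ^ n.+1] is a combination of lower powers with coefficients in [u^-1 A] *)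
  have ez : z ^+ n.+1 =
      \sum_(i < m.+1) (u^-1 * b i.+1 / s) * z ^+ (n - i).
    have es : s * z ^+ n.+1 = \sum_(i < m.+1) (u^-1 * b i.+1) * z ^+ (n - i).
      have : u^-1 * u = 1 by rewrite mulVf.
      rewrite {2}eb big_ord_recl expr0 mulr1 mulrDr => /(canRL (addKr _)).
      rewrite addrC -mulrN -/s => <-; rewrite -mulrA mulr_suml mulr_sumr.
      apply: eq_bigr => i _; rewrite -!mulrA; congr (_ * (_ * _)).
      have -> : n.+1 = ((n - i) + i.+1)%N by have := ltn_ord i; lia.
      by rewrite exprD mulrCA -exprMn mulVf // expr1n mulr1; congr (_ ^+ _); lia.
    rewrite -[LHS](mulKf s0) es mulr_sumr; apply: eq_bigr => i _.
    by rewrite mulrA [s^-1 * _]mulrC.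
  exists (fun i => a i + if (n <= i + m)%N then a n.+1 * (u^-1 * b (n - i).+1 / s)
                         else 0).
    move=> i; apply: (subringD hA) => //; case: ifP => _; last exact: subring0.
    by do 3?apply: (subringM hA).
  rewrite {1}ea big_ord_recr /= ez.
  under [RHS]eq_bigr do rewrite mulrDl.
  rewrite big_split /=; congr (_ + _).
  pose G k := a n.+1 * (u^-1 * b k.+1 / s) * z ^+ (n - k).
  transitivity (\sum_(i < m.+1) G i).
    by rewrite mulr_sumr; apply: eq_bigr => i _; rewrite /G mulrA.
  rewrite (big_ord_widen n.+1 G) // big_mkcond [RHS](reindex_inj rev_ord_inj) /=.
  apply: eq_bigr => i _; have ilt := ltn_ord i.
  have -> : (n - (n.+1 - i.+1) = i)%N by lia.
  have -> : (n <= n.+1 - i.+1 + m)%N = (i < m.+1)%N by lia.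
  by case: ifP => _; rewrite ?mul0r // /G subSS.
have absurd N : forall z n m, z != 0 -> (n + m <= N)%N -> rep z n -> rep z^-1 m -> False.
  elim: N => [|N IH] z n m z0.
    by case: n => [|//] _ /rep0.
  wlog nm : z n m z0 / (m <= n)%N.
    move=> H; have [mn|/ltnW nm] := leqP m n; first exact: H.
    move=> le rn rm; apply: (H z^-1 m n) => //; first by rewrite invr_eq0.
      by rewrite addnC.
    by rewrite invrK.
  case: n nm => [|n] nm; first by move=> _ /rep0.
  case: m nm => [|m] nm; first by move=> _ _ /rep0.
  move=> le rn rm; apply: (IH z n m.+1 z0) => //.
  exact: (red z n m z0 nm rn rm).
exists A; split=> //; split=> // z z0; apply: contrapT => /not_orP [Az Az'].
have [n rn] := adj_rep _ Az; have [m rm] := adj_rep _ Az'.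
exact: (absurd (n + m)%N z n m z0 (leqnn _) rn rm).
Qed.

End Chevalley.

(** * Extending a discrete valuation to a finite extension *)

Section Leading.

Variables (E : fieldType) (A : set E).
Hypothesis vA : valuation_subring A.
Let hA := vA.1.

(** The nonunits of a valuation ring are stable under sums, as one of the two
    terms divides the other. *)
Lemma unit_inD a b : A a -> A b -> unit_in A (a + b) ->
  unit_in A a \/ unit_in A b.
Proof.
have [->|a0] := eqVneq a 0; first by rewrite add0r => *; right.
have [->|b0] := eqVneq b 0; first by rewrite addr0 => *; left.
have main c d : c != 0 -> A c -> A (d / c) -> unit_in A (c + d) -> unit_in A c.
  move=> c0 Ac Adc [s0 As As']; split=> //.
  have -> : c^-1 = (1 + d / c) * (c + d)^-1.
    apply: (mulfI c0); rewrite divff // mulrA mulrDr mulr1 mulrCA divff // mulr1.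
    by rewrite divff.
  by apply: (subringM hA) => //; apply: (subringD hA) (subring1 hA) _.
move=> Aa Ab; have ba0 : b / a != 0 by rewrite mulf_neq0 ?invr_eq0.
have [Aba|] := vA.2 _ ba0; first by left; apply: main Aba _.
by rewrite invfM invrK mulrC addrC => Aab; right; apply: main Aab _.
Qed.

Lemma exists_least (I : eqType) (x : I -> E) (s : seq I) :
  (exists2 i, i \in s & x i != 0) ->
  exists j, [/\ j \in s, x j != 0 & forall i, i \in s -> A (x i / x j)].
Proof.
elim: s => [[i]//|a s IH] ex.
have [exs|nexs] := pselect (exists2 i, i \in s & x i != 0); last first.
  have xs0 i : i \in s -> x i = 0.
    by move=> si; apply/eqP; apply: contrapT => /negP xi; apply: nexs; exists i.
  have xa : x a != 0.
    case: ex => i; rewrite inE => /orP[/eqP->//|si].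
    by rewrite xs0 // eqxx.
  exists a; split=> //; first exact: mem_head.
  move=> i; rewrite inE => /orP[/eqP->|/xs0->].
    by rewrite divff //; exact: (subring1 hA).
  by rewrite mul0r; exact: subring0.
have [j [js xj jmin]] := IH exs.
have [Aaj|nAaj] := pselect (A (x a / x j)).
  exists j; split=> //; first by rewrite inE js orbT.
  by move=> i; rewrite inE => /orP[/eqP->//|/jmin].
have xa : x a != 0.
  by apply/eqP => xa; apply: nAaj; rewrite xa mul0r; exact: subring0.
have Aja : A (x j / x a).
  have aj0 : x a / x j != 0 by rewrite mulf_neq0 ?invr_eq0.
  have [//|] := vA.2 _ aj0.
  by rewrite invfM invrK mulrC.
exists a; split=> //; first exact: mem_head.
move=> i; rewrite inE => /orP[/eqP->|/jmin Aij].
  by rewrite divff //; exact: (subring1 hA).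
rewrite (_ : x i / x a = (x i / x j) * (x j / x a)); first exact: (subringM hA).
by rewrite mulrA divfK.
Qed.

(** A unique term of least value would, after division by it, exhibit [-1] as a
    sum of nonunits. *)
Lemma two_leading_terms n (x : 'I_n -> E) :
  \sum_i x i = 0 -> (exists i, x i != 0) ->
  exists i j, i != j /\ unit_in A (x i / x j).
Proof.
move=> sum0 [i0 xi0].
have [|j [_ xj jmin]] := @exists_least _ x (enum 'I_n).
  by exists i0 => //; rewrite mem_enum.
have {}jmin i : A (x i / x j) by apply: jmin; rewrite mem_enum.
apply: contrapT => none.
have nonunit i : i != j -> ~ unit_in A (x i / x j).
  by move=> ij u; apply: none; exists i, j.
have : A (\sum_(i | i != j) x i / x j) /\ ~ unit_in A (\sum_(i | i != j) x i / x j).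
  elim/big_rec: _ => [|i s ij [As nus]].
    by split; [exact: subring0 | case; rewrite eqxx].
  split; first exact: subringD.
  by move=> /(unit_inD (jmin i) As) [/(nonunit i ij)|].
move=> [_]; apply.
have -> : \sum_(i | i != j) x i / x j = -1.
  apply/eqP; rewrite -addr_eq0 addrC -(divff xj).
  by rewrite -(bigD1 j (P := xpredT) (F := fun i => x i / x j)) //= -mulr_suml sum0 mul0r.
split; rewrite ?oppr_eq0 ?oner_eq0 ?invrN1 //.
  by apply: subringN => //; exact: (subring1 hA).
by apply: subringN => //; exact: (subring1 hA).
Qed.

End Leading.

Lemma scalar_eq0 (K : fieldType) (L : fieldExtType K) (c : K) :
  (c%:A == 0 :> L) = (c == 0).
Proof. by rewrite scaler_eq0 oner_eq0 orbF. Qed.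

Section Extension.

Variables (K : fieldType) (L : fieldExtType K) (v : K -> int).
Hypothesis hv : normalized_valuation v.

(** For a normalized [w], which cannot be nonnegative on the whole of [K] as [L]
    is algebraic over [K], this forces the restriction of [w] to [K] to be a
    positive multiple of [v]. *)
Definition lies_above (w : L -> int) : Prop :=
  forall c : K, 0 <= v c -> 0 <= w c%:A.

(** The algebra generated by [z] over the valuation ring of [v]. *)
Definition integral_span (z : L) : set L :=
  [set x | exists2 p : {poly K}, forall i, val_ge v 0 p`_i &
           x = (map_poly (in_alg L) p).[z]]%classic.

Lemma integral_span_subring z : subring (integral_span z).
Proof.
split.
- exists 1; last by rewrite rmorph1 hornerE.
  by move=> i; rewrite coef1; case: (i == _); [exact: val_ge1 | exact: val_ge0].
- move=> _ _ [p hp ->] [q hq ->]; exists (p - q); last by rewrite rmorphB !hornerE.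
  by move=> i; rewrite coefB; apply: val_geD => //; rewrite val_geN.
- move=> _ _ [p hp ->] [q hq ->]; exists (p * q); last by rewrite rmorphM hornerM.
  move=> i; rewrite coefM; apply: val_ge_sum => // j _.
  by rewrite -[0]addr0; exact: val_geM.
Qed.

Lemma integral_span_gen z : integral_span z z.
Proof.
exists 'X; last by rewrite map_polyX hornerX.
by move=> i; rewrite coefX; case: (i == _); [exact: val_ge1 | exact: val_ge0].
Qed.

Lemma integral_span_scalar z c : 0 <= v c -> integral_span z c%:A.
Proof.
move=> vc; exists c%:P; last by rewrite map_polyC hornerC.
by move=> i; rewrite coefC; case: (i == _); rewrite ?val_ge0 // /val_ge vc orbT.
Qed.

Lemma base_polyP (p : {poly L}) : p \is a polyOver 1%VS ->
  exists c : nat -> K, forall i, p`_i = (c i)%:A.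
Proof.
move=> /polyOverP hp; have ex i : exists c : K, p`_i = c%:A.
  by have /vlineP[c ->] := hp i; exists c.
by have [c] := choice ex; exists c.
Qed.

Section ValuationSubringAbove.

Variables (A : set L) (u : L) (t : K).
Hypotheses (vA : valuation_subring A) (Au : ~ A u) (Au' : A u^-1).
Hypotheses (AK : forall c : K, 0 <= v c -> A c%:A) (vt : v t = 1).
Let hA := vA.1.
Let T : L := t%:A.

Lemma uniformizer_neq0 : t != 0.
Proof. by apply/eqP => t0; move: vt; rewrite t0 (valuation0 hv). Qed.

Lemma lift_uniformizer_neq0 : T != 0.
Proof. by rewrite scalar_eq0; exact: uniformizer_neq0. Qed.

(** Otherwise the subring would contain the base field, hence the field
    generated by [u^-1], which contains [u]. *)
Lemma uniformizer_nonunit : ~ A T^-1.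
Proof.
move=> AT'; have AKall (c : K) : A c%:A.
  have [->|c0] := eqVneq c 0; first by rewrite scale0r; exact: subring0.
  pose n := `|v c|%N; have -> : c%:A = (c * t ^+ n)%:A * T^-1 ^+ n :> L.
    rewrite -!in_algE rmorphM rmorphXn /= -mulrA -exprMn divff ?lift_uniformizer_neq0 //.
    by rewrite expr1n mulr1.
  apply: (subringM hA); last exact: subringX.
  by apply: AK; rewrite (valuationM hv) ?expf_neq0 ?uniformizer_neq0 // (valuationX hv) vt; lia.
apply: Au; have : u \in <<1; u^-1>>%VS.
  by rewrite -[X in X \in _]invrK memvV memv_adjoin.
move=> /Fadjoin_polyP [p /base_polyP[c pc] ->].
rewrite horner_coef; apply: (subring_sum hA) => i _; rewrite pc.
by apply: (subringM hA) => //; exact: subringX.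
Qed.

Lemma scalar_unit_multiple (c : K) : c != 0 -> unit_in A (c%:A / T ^ v c).
Proof.
move=> c0; have main (d : K) (m : int) : d != 0 -> m = v d ->
    A (d%:A / T ^ m).
  move=> d0 ->; have -> : d%:A / T ^ v d = (d / t ^ v d)%:A :> L.
    by rewrite -!in_algE fmorph_div rmorphXz // unitfE uniformizer_neq0.
  apply: AK; rewrite (valuationM hv) ?invr_eq0 ?expfz_neq0 ?uniformizer_neq0 //.
  by rewrite (valuationV hv) (valuationXz hv) vt; lia.
split; [|exact: main|].
  by rewrite mulf_neq0 ?invr_eq0 ?expfz_neq0 ?lift_uniformizer_neq0 // scalar_eq0.
rewrite invfM invr_expz.
have := main c^-1 (- v c); rewrite invr_eq0 (valuationV hv) => /(_ c0 erefl).
by rewrite -!in_algE fmorphV.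
Qed.

(** The powers [1, z, ..., z ^ n] with [n] the degree are linearly dependent,
    so two of them have values differing by an element of the value group of
    the base field. *)
Lemma power_commensurable z : z != 0 ->
  exists m : int, unit_in A (z ^+ (\dim {:L})`! / T ^ m).
Proof.
move=> z0; set n := adjoin_degree 1%AS z.
have nle : (n <= \dim {:L})%N.
  rewrite /n /adjoin_degree prednK; last first.
    by rewrite divn_gt0 ?dimv1 // adim_gt0.
  by rewrite dimv1 divn1 dimvS // subvf.
have [c qc] := base_polyP (minPolyOver 1%AS z).
have sz := size_minPoly 1%AS z; rewrite -/n in sz.
have := root_minPoly 1%AS z; rewrite /root horner_coef sz => /eqP sum0.
have [|i [j [ij]]] := two_leading_terms vA sum0.
  exists ord_max; rewrite mulf_neq0 ?expf_neq0 //=.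
  have := monic_minPoly 1%AS z; rewrite monicE lead_coefE sz /= => /eqP->.
  exact: oner_neq0.
move=> /[dup] [[]] + _ _; rewrite mulf_eq0 invr_eq0 !mulf_eq0 !expf_eq0.
rewrite (negbTE z0) !andbF !orbF !qc => /norP[ci cj].
have {}ci : c i != 0 by move: ci; rewrite scalar_eq0.
have {}cj : c j != 0 by move: cj; rewrite scalar_eq0.
wlog {ij} ij : i j ci cj / (j < i)%N.
  move=> H; have : (val i != val j) by [].
  rewrite neq_ltn => /orP[lt uij|]; last exact: H.
  by apply: (H j i) => //; rewrite -invf_div; exact: unit_inV.
move=> uij; pose k := (i - j)%N.
have {}uij : unit_in A (z ^+ k / T ^ (v (c j) - v (c i))).
  have := unit_inM hA (unit_inM hA uij (unit_inV (scalar_unit_multiple ci))) (scalar_unit_multiple cj).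
  congr unit_in; rewrite expfzDr ?lift_uniformizer_neq0 //.
  have -> : z ^+ i = z ^+ k * z ^+ j by rewrite -exprD subnK // ltnW.
  have c'i : (c i)%:A != 0 :> L by rewrite scalar_eq0.
  have c'j : (c j)%:A != 0 :> L by rewrite scalar_eq0.
  have Ti := expfz_neq0 (v (c i)) lift_uniformizer_neq0; have Tj := expfz_neq0 (v (c j)) lift_uniformizer_neq0.
  have zj := expf_neq0 j z0.
  rewrite -invr_expz; move: Ti Tj zj c'i c'j.
  move: (T ^ v (c i)) (T ^ v (c j)) (z ^+ j) (z ^+ k) => a b x y.
  move: ((c i)%:A) ((c j)%:A) => e f ? ? ? ? ?.
  by field; apply/and5P.
have kN : (k %| (\dim {:L})`!)%N.
  apply: dvdn_fact; rewrite subn_gt0 ij /=; apply: leq_trans (leq_subr _ _) _.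
  by rewrite (leq_trans _ nle) // -ltnS.
exists ((v (c j) - v (c i)) * ((\dim {:L})`! %/ k)%N%:Z).
have := unit_inX hA ((\dim {:L})`! %/ k)%N uij.
by rewrite exprMn -exprM exprVn exprnP exprz_exp [(k * _)%N]mulnC divnK.
Qed.

End ValuationSubringAbove.

(** If [u] is not integral over the valuation ring of [v], then [u] is not a
    polynomial in [u^-1] over that ring; a valuation ring containing [u^-1] but
    not [u] yields the pole. *)
Lemma exists_valuation_neg (u : L) : u != 0 -> ~ integral_span u^-1 u ->
  exists w, [/\ normalized_valuation w, lies_above w & w u < 0].
Proof.
move=> u0 nspan; have [A [vA A0A Au]] := exists_valuation_subring
  (integral_span_subring u^-1) u0 (integral_span_gen u^-1) nspan.
have [t t0 vt] := valuation_surj hv 1.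
have AK c : 0 <= v c -> A c%:A by move=> vc; apply/A0A/integral_span_scalar.
have Au' : A u^-1 := A0A _ (integral_span_gen _).
have AT : A t%:A by apply: AK; rewrite vt.
have [w [hw wA]] := valuation_of_subring vA (fact_gt0 _) (lift_uniformizer_neq0 vt) AT
  (uniformizer_nonunit vA Au Au' AK vt) (power_commensurable vA AK vt).
exists w; split=> //.
  move=> c vc; have [->|c0] := eqVneq c 0; first by rewrite scale0r (valuation0 hw).
  by apply/wA; [rewrite scalar_eq0 | exact: AK].
by rewrite ltNge; apply/negP => /(wA _ u0).
Qed.

End Extension.

(** * Norms of elements without poles *)

Import passmx.
Section Norm.

Variables (K : fieldType) (L : fieldExtType K).

Definition mul_mx (a : L) : 'M[K]_(\dim {:L}) :=
  passmx.mxof (vbasis {:L}) (vbasis {:L}) (amull a).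

Definition norm (a : L) : K := \det (mul_mx a).

Lemma mul_mx_lincomb (k : nat) (r : 'I_k -> K) (x : 'I_k -> L) :
  mul_mx (\sum_i (r i)%:A * x i) = \sum_i r i *: mul_mx (x i).
Proof.
elim/big_rec2: _ => [|i M y _ <-]; first by rewrite /mul_mx !linear0.
by rewrite mulr_algl /mul_mx !linearP.
Qed.

Lemma mul_mxM a b : mul_mx (a * b) = mul_mx b *m mul_mx a.
Proof.
rewrite /mul_mx -passmx.mxof_comp ?vbasisP //; congr passmx.mxof.
by apply/lfunP => w; rewrite comp_lfunE !lfunE /= mulrA.
Qed.

Lemma norm1 : norm 1 = 1.
Proof.
by rewrite /norm /mul_mx amull1 passmx.mxof1 ?det1 // (basis_free (vbasisP _)).
Qed.

Lemma normM a b : norm (a * b) = norm a * norm b.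
Proof. by rewrite /norm mul_mxM det_mulmx mulrC. Qed.

Lemma normX a n : norm (a ^+ n) = norm a ^+ n.
Proof.
elim: n => [|n IH]; first by rewrite !expr0 norm1.
by rewrite !exprS normM IH.
Qed.

Lemma norm_neq0 a : a != 0 -> norm a != 0.
Proof.
move=> a0; apply/eqP => n0; have := norm1.
by rewrite -(divff a0) normM n0 mul0r => /esym/eqP; rewrite oner_eq0.
Qed.

Variable v : K -> int.
Hypothesis hv : normalized_valuation v.

(** All powers of [z] have matrices with a common bound on the denominators,
    because they reduce to finitely many; hence so do all powers of the norm,
    which forces the norm itself to have no denominator. *)
Lemma norm_integral (z : L) (k : nat) (r : nat -> K) :
  z != 0 -> (forall i, val_ge v 0 (r i)) ->
  z ^+ k = \sum_(i < k) (r i)%:A * z ^+ i -> 0 <= v (norm z).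
Proof.
move=> z0 hr ez; set n := \dim {:L}.
pose f (x : 'I_k * ('I_n * 'I_n)) := `|v (mul_mx (z ^+ x.1) x.2.1 x.2.2)|%N.
pose d := \max_x f x.
have bnd j a b : val_ge v (- d%:Z) (mul_mx (z ^+ j) a b).
  elim/ltn_ind: j => j IH; have [jk|kj] := ltnP j k.
    have := leq_bigmax (F := f) (Ordinal jk, (a, b)).
    by rewrite -/d /f /val_ge /= => le; apply/orP; right; lia.
  rewrite -(subnK kj) exprD ez mulr_sumr.
  under eq_bigr => i _ do rewrite mulrCA -exprD.
  rewrite mul_mx_lincomb summxE; apply: val_ge_sum => // i _; rewrite mxE.
  by rewrite -[- _]add0r; apply: val_geM => //; apply: IH; have := ltn_ord i; lia.
have nz : norm z != 0 by exact: norm_neq0.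
rewrite leNgt; apply/negP => neg.
have := val_ge_det hv (bnd (d * n).+1); rewrite -/(norm _) normX.
rewrite val_geE ?expf_neq0 // (valuationX hv); nia.
Qed.

(** Multiplying an expression of [u] as a polynomial in [u^-1] by a power of
    [u] gives an integral equation for [u]. *)
Lemma norm_integral_span (u : L) : u != 0 -> integral_span v u^-1 u ->
  0 <= v (norm u).
Proof.
move=> u0 [p hp]; rewrite horner_coef size_map_poly.
case sp : (size p) => [|k]; first by rewrite big_ord0 => /eqP; rewrite (negbTE u0).
move=> eu; apply: (norm_integral (k := k.+1) (r := fun i => p`_(k - i))) => //.
rewrite exprSr {2}eu mulr_sumr [RHS](reindex_inj rev_ord_inj) /=.
apply: eq_bigr => i _; have ilt := ltn_ord i; rewrite coef_map /= subSS subKn //.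
rewrite mulrCA exprVn; congr (_ * _).
by rewrite -[X in u ^+ X * _](@subnK i) // exprD mulfK // expf_neq0.
Qed.

(** Either [u] is a polynomial in [u^-1] over the valuation ring of [v], and its
    norm is integral, or Chevalley's argument produces a pole of [u]. *)
Lemma norm_ge0 (u : L) : u != 0 ->
  (forall w, normalized_valuation w -> lies_above v w -> 0 <= w u) ->
  0 <= v (norm u).
Proof.
move=> u0 pos; apply: norm_integral_span => //; apply: contrapT => nspan.
have [w [hw ab]] := exists_valuation_neg hv u0 nspan.
by rewrite ltNge pos.
Qed.

End Norm.

(** * Weak approximation and values of norms *)

Section Approximation.

Variable E : fieldType.
Implicit Types (w : E -> int) (s : seq (E -> int)).

(** The valuation ring determines a normalized valuation, and a discrete
    valuation ring is a maximal proper subring: units of [w1] are units of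
    [w2], so [w2] is [w1] times the value of a uniformizer of [w1], which is [1]
    by surjectivity. *)
Lemma valuation_eq w1 w2 : normalized_valuation w1 -> normalized_valuation w2 ->
  (forall a, a != 0 -> 0 <= w1 a -> 0 <= w2 a) -> w1 = w2.
Proof.
move=> h1 h2 pos; have [t t0 t1] := valuation_surj h1 1.
have zero a : a != 0 -> w1 a = 0 -> w2 a = 0.
  move=> a0 wa; have := pos a a0; rewrite wa => /(_ isT).
  have := pos a^-1; rewrite invr_eq0 (valuationV h1) (valuationV h2) wa.
  by move=> /(_ a0 isT); lia.
have prop a : a != 0 -> w2 a = w1 a * w2 t.
  move=> a0; have Tn : t ^ (- w1 a) != 0 by rewrite expfz_neq0.
  have := zero (a * t ^ (- w1 a)); rewrite mulf_neq0 // (valuationM h1) //.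
  rewrite (valuationM h2) // (valuationXz h1) (valuationXz h2) t1.
  by move=> /(_ isT); lia.
have [b b0 wb] := valuation_surj h2 1.
have := prop b b0; have := pos t t0; rewrite wb t1 => tpos e.
have wt : w2 t = 1 by exact: mulz_eq1_ge0 (esym e) (tpos isT).
apply/funext => a; have [->|a0] := eqVneq a 0.
  by rewrite (valuation0 h1) (valuation0 h2).
by rewrite prop // wt mulr1.
Qed.

Lemma separate2 w1 w2 : normalized_valuation w1 -> normalized_valuation w2 ->
  w1 <> w2 -> exists2 z, z != 0 & 0 < w1 z /\ w2 z < 0.
Proof.
have half (u1 u2 : E -> int) : normalized_valuation u1 -> normalized_valuation u2 ->
    u1 <> u2 -> exists2 a, a != 0 & 0 <= u1 a /\ u2 a < 0.
  move=> h1 h2 ne; apply: contrapT => none; apply: ne; apply: valuation_eq => // a a0 pos.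
  by rewrite leNgt; apply/negP => neg; apply: none; exists a.
move=> h1 h2 ne; have [a a0 [a1 a2]] := half _ _ h1 h2 ne.
have [b b0 [b2 b1]] := half _ _ h2 h1 (nesym ne).
exists (a / b); first by rewrite mulf_neq0 ?invr_eq0.
by rewrite (valuationM h1) ?(valuationM h2) ?invr_eq0 // (valuationV h1) (valuationV h2); lia.
Qed.

Lemma bounded_on_seq (T : eqType) (s : seq T) (f : T -> int) :
  exists k : nat, forall x, x \in s -> f x < k%:Z.
Proof.
elim: s => [|a s [k IH]]; first by exists 0%N.
exists (k + `|f a|.+1)%N => x; rewrite inE => /orP[/eqP->|/IH]; lia.
Qed.

(** If [z] works for [s] but not for a further valuation [w1], then adding a
    high power of an element separating [w] from [w1] repairs it. *)
Lemma separate w s : normalized_valuation w ->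
  (forall w', w' \in s -> normalized_valuation w' /\ w <> w') ->
  exists2 z, z != 0 & 0 < w z /\ forall w', w' \in s -> w' z < 0.
Proof.
move=> hw; elim: s => [|w1 s IH] hs.
  by have [t t0 t1] := valuation_surj hw 1; exists t => //; rewrite t1.
have [h1 ne] := hs w1 (mem_head _ _).
have {}hs w' : w' \in s -> normalized_valuation w' /\ w <> w'.
  by move=> sw; apply: hs; rewrite inE sw orbT.
have [z z0 [wz sz]] := IH hs.
have [neg|pos] := ltP (w1 z) 0.
  by exists z => //; split=> // w'; rewrite inE => /orP[/eqP->|/sz].
have [y y0 [wy w1y]] := separate2 hw h1 ne.
have [k hk] := bounded_on_seq s (fun w' => `|w' z|%N%:Z).
have yk0 : y ^+ k.+1 != 0 by rewrite expf_neq0.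
exists (z + y ^+ k.+1).
  rewrite addrC; have [|//] := valuationD_lt h1 yk0 z0.
  by rewrite (valuationX h1); nia.
have zyk : z + y ^+ k.+1 != 0.
  rewrite addrC; have [|//] := valuationD_lt h1 yk0 z0.
  by rewrite (valuationX h1); nia.
split.
  apply: lt_le_trans (valuationD hw z0 yk0 zyk).
  by rewrite lt_min wz (valuationX hw) /=; nia.
move=> w'; rewrite inE => /orP[/eqP->|sw].
  rewrite addrC; have [|_ ->] := valuationD_lt h1 yk0 z0.
    by rewrite (valuationX h1); nia.
  by rewrite (valuationX h1); nia.
have [h' _] := hs w' sw; have := sz w' sw; have := hk w' sw => zk neg.
have vyk := valuationX h' y k.+1.
have [w'y|w'y] := ltP (w' y) 0.
  rewrite addrC; have [|_ ->] := valuationD_lt h' yk0 z0; rewrite vyk; nia.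
by have [|_ ->] := valuationD_lt h' z0 yk0; rewrite ?vyk //; nia.
Qed.

(** Weak approximation. With [z] separating [w] from [s], the elements
    [1 / (1 + z)] and [z / (1 + z)] are a unit at [w], resp. at [s], and
    arbitrarily small powers of them at the other places glue the two parts. *)
Lemma approximation s (d : (E -> int) -> int) : uniq s ->
  (forall w, w \in s -> normalized_valuation w) ->
  exists2 b, b != 0 & forall w, w \in s -> w b = d w.
Proof.
elim: s => [|w s IH]; first by exists 1; rewrite ?oner_neq0.
move=> /= /andP[ws us] hs; have hw := hs w (mem_head _ _).
have {}hs w' : w' \in s -> normalized_valuation w'.
  by move=> sw; apply: hs; rewrite inE sw orbT.
have [b b0 hb] := IH us hs.
have [c c0 wc] := valuation_surj hw (d w).
have [|z z0 [wz sz]] := @separate w s hw.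
  by move=> w' sw; split; [exact: hs | move=> e; rewrite e sw in ws].
have [wz1 w1z] : 1 + z != 0 /\ w (1 + z) = 0.
  have := valuationD_lt hw (oner_neq0 E) z0; rewrite (valuation1 hw); exact.
have sz1 w' : w' \in s -> w' (1 + z) = w' z.
  move=> sw; rewrite addrC.
  have [|//] := valuationD_lt (hs _ sw) z0 (oner_neq0 E).
  by rewrite (valuation1 (hs _ sw)); exact: sz.
have [k hk] := bounded_on_seq s (fun w' => d w' - w' c).
have [m [km dm]] : exists m : nat, (k <= m)%N /\ d w - w b < m%:Z.
  by exists (k + `|d w - w b|.+1)%N; split; lia.
pose x := (1 + z)^-1 ^+ m * c; pose y := (z / (1 + z)) ^+ m * b.
have z1' : (1 + z)^-1 != 0 by rewrite invr_eq0.
have zz1 : z / (1 + z) != 0 by rewrite mulf_neq0.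
have x0 : x != 0 by rewrite mulf_neq0 // expf_neq0.
have y0 : y != 0 by rewrite mulf_neq0 // expf_neq0.
have val_x w' : normalized_valuation w' -> w' x = w' c - m%:Z * w' (1 + z).
  move=> h'; rewrite /x (valuationM h') ?expf_neq0 // (valuationX h') (valuationV h').
  by rewrite mulrN addrC.
have val_y w' : normalized_valuation w' ->
    w' y = w' b + m%:Z * (w' z - w' (1 + z)).
  move=> h'; rewrite /y (valuationM h') ?expf_neq0 // (valuationX h').
  by rewrite (valuationM h') // (valuationV h') addrC.
have atw : x + y != 0 /\ w (x + y) = d w.
  have wx : w x = d w by rewrite val_x // w1z wc mulr0 subr0.
  rewrite -wx; apply: valuationD_lt => //; rewrite wx val_y // w1z subr0.
  have : m%:Z <= m%:Z * w z by rewrite ler_peMr.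
  by rewrite addrC -ltrBlDr => /(lt_le_trans dm).
exists (x + y); first exact: atw.1.
move=> w'; rewrite inE => /orP[/eqP->|sw]; first exact: atw.2.
have h' := hs _ sw; have := hk _ sw => lek; have := sz _ sw => zneg.
have yd : w' y = d w' by rewrite val_y // sz1 // hb // subrr mulr0 addr0.
rewrite addrC -yd; apply: (valuationD_lt h' y0 x0 _).2.
rewrite yd val_x // sz1 // -mulrN.
have : m%:Z <= m%:Z * - w' z by rewrite ler_peMr //; move: zneg; clear; intros_lia.
by move: lek km; move: (d w') (w' c) (_ * _) => p q r; clear; intros_lia.
Qed.

End Approximation.

Section FinitelyMany.

Variables (K : fieldType) (L : fieldExtType K) (v : K -> int).
Hypothesis hv : normalized_valuation v.

Let above (w : L -> int) := normalized_valuation w /\ lies_above v w.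

(** Elements with a pole at exactly one of the valuations and zeros at the
    others are linearly independent. *)
Lemma size_above (s : seq (L -> int)) : uniq s ->
  (forall w, w \in s -> above w) -> (size s <= \dim {:L})%N.
Proof.
move=> us hs.
have ex w : exists z : L, w \in s -> [/\ z != 0, w z < 0 &
    forall w', w' \in s -> w' != w -> 0 < w' z].
  have [sw|] := boolP (w \in s); last by exists 0.
  have [||z z0 [wz sz]] := @separate _ w (rem w s); first exact: (hs _ sw).1.
    move=> w'; rewrite (mem_rem_uniq w us) inE => /andP[ne sw'].
    by split; [exact: (hs _ sw').1 | move=> e; rewrite e eqxx in ne].
  exists z^-1 => _; rewrite invr_eq0 (valuationV (hs _ sw).1); split=> //.
    by rewrite oppr_lt0.
  move=> w' sw' ne; rewrite (valuationV (hs _ sw').1) oppr_gt0; apply: sz.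
  by rewrite (mem_rem_uniq w us) inE ne.
have [z hz] := choice ex.
suff fr : free (map z s) by rewrite -(size_map z) -(eqnP fr) dimvS // subvf.
rewrite -[map z s]/(tval (map_tuple z (in_tuple s))).
apply/freeP => c sum0 i; apply/eqP; apply: contrapT => /negP ci.
(* divide the relation by a coefficient of least value *)
have [j [cj jmin]] : exists j, c j != 0 /\ forall i, c i != 0 -> v (c j) <= v (c i).
  have [j cj jmin] := @arg_minP _ _ _ i (fun i => c i != 0) (fun i => v (c i)) ci.
  by exists j.
pose d0 : L -> int := fun=> 0.
have sj (k : 'I_(size s)) : nth d0 s k \in s by apply: mem_nth.
set wj := nth d0 s j.
have hj := (hs wj (sj j)).1; have aj := (hs wj (sj j)).2.
have zE (k : 'I_(size s)) : (map_tuple z (in_tuple s))`_k = z (nth d0 s k).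
  by rewrite /= (nth_map d0).
have : val_ge wj 1 (\sum_(k < size s | k != j) (c k / c j)%:A * z (nth d0 s k)).
  apply: val_ge_sum => // k kj.
  rewrite -[1]add0r; apply: val_geM => //.
    have [->|ck] := eqVneq (c k) 0; first by rewrite mul0r scale0r val_ge0.
    rewrite /val_ge aj ?orbT // (valuationM hv) ?invr_eq0 // (valuationV hv).
    by have := jmin k ck; lia.
  have [_ _ /(_ wj (sj j)) pos] := hz _ (sj k).
  have : 0 < wj (z (nth d0 s k)).
    by apply: pos; rewrite /wj nth_uniq // eq_sym; exact: kj.
  by rewrite /val_ge => zk; apply/orP; right; lia.
have -> : \sum_(k < size s | k != j) (c k / c j)%:A * z (nth d0 s k) = - z wj.
  apply/eqP; rewrite -addr_eq0 addrC.
  have -> : z wj = (c j / c j)%:A * z (nth d0 s j).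
    by rewrite divff // scale1r mul1r.
  rewrite -(bigD1 j (P := xpredT)
    (F := fun k : 'I_(size s) => (c k / c j)%:A * z (nth d0 s k))) //=.
  under eq_bigr => k _ do rewrite mulr_algl mulrC -scalerA -zE.
  by rewrite -scaler_sumr sum0 scaler0.
rewrite val_geN //; have [zj0 neg _] := hz _ (sj j).
by rewrite val_geE // -/wj; rewrite -/wj in neg; lia.
Qed.

(** Each new valuation can be added to a list of distinct ones, whose length is
    bounded by the degree. *)
Lemma finitely_many_above : exists2 s : seq (L -> int), uniq s &
  forall w, w \in s <-> above w.
Proof.
suff H n : (exists2 s : seq (L -> int), uniq s & forall w, w \in s <-> above w) \/
    exists s : seq (L -> int), [/\ uniq s, size s = n & forall w, w \in s -> above w].
  have [//|[s [us sz hs]]] := H (\dim {:L}).+1.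
  by have := size_above us hs; rewrite sz ltnn.
elim: n => [|n [|[s [us sz hs]]]]; [by right; exists [::] | by left |].
have [[w [hw ws]]|none] := pselect (exists w, above w /\ w \notin s).
  right; exists (w :: s); split=> //=; rewrite ?ws ?sz // => w'.
  by rewrite inE => /orP[/eqP->|/hs].
left; exists s => // w; split; first exact: hs.
by move=> hw; apply: contrapT => /negP ws; apply: none; exists w.
Qed.

(** By weak approximation, [a] is a [p]-th power times a unit above [v], and
    the norm of such a unit has value zero. *)
Lemma dvd_val_norm (p : nat) (a : L) : a != 0 ->
  (forall w, normalized_valuation w -> lies_above v w -> (p%:Z %| w a)%Z) ->
  (p%:Z %| v (norm a))%Z.
Proof.
move=> a0 hp; have [s us hs] := finitely_many_above.
have [|b b0 hb] := @approximation _ s (fun w => (w a %/ p)%Z) us.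
  by move=> w /hs[].
have bp0 : b ^+ p != 0 by rewrite expf_neq0.
pose u := a / b ^+ p; have u0 : u != 0 by rewrite mulf_neq0 ?invr_eq0.
have u0' : u^-1 != 0 by rewrite invr_eq0.
have wu w : normalized_valuation w -> lies_above v w -> w u = 0.
  move=> hw ab; rewrite (valuationM hw) ?invr_eq0 // (valuationV hw) (valuationX hw).
  rewrite hb; last exact/hs.
  by rewrite mulrC divzK ?subrr //; exact: hp.
have n1 : 0 <= v (norm u) by apply: norm_ge0 => // w hw ab; rewrite wu.
have n2 : 0 <= v (norm u^-1).
  by apply: norm_ge0 => // w hw ab; rewrite (valuationV hw) wu.
have vu : v (norm u) = 0.
  have := valuationM hv (norm_neq0 u0) (norm_neq0 u0').
  by rewrite -normM divff // norm1 (valuation1 hv); lia.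
have -> : a = u * b ^+ p by rewrite /u divfK.
rewrite normM normX (valuationM hv) ?expf_neq0 ?norm_neq0 // vu add0r.
by rewrite (valuationX hv) dvdz_mulr.
Qed.

End FinitelyMany.

Lemma subf_div (E : fieldType) (a b c d : E) : b != 0 -> d != 0 ->
  a / b - c / d = (a * d - c * b) / (b * d).
Proof. by move=> b0 d0; rewrite -mulNr addf_div // mulNr. Qed.

(** * Adic valuations of the rational function field *)

Lemma divf_neq0 (E : fieldType) (a b : E) : a != 0 -> b != 0 -> a / b != 0.
Proof. by move=> a0 b0; rewrite mulf_neq0 ?invr_eq0. Qed.

Lemma divf_expz (E : fieldType) (t c d : E) (a b : nat) : t != 0 ->
  (t ^+ a * c) / (t ^+ b * d) / t ^ (a%:Z - b%:Z) = c / d.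
Proof.
move=> t0; rewrite expfzDr // -exprnP -exprnN -(mulf_div _ _ c d).
by rewrite mulrC mulKf // mulf_neq0 ?invr_eq0 ?expf_neq0.
Qed.

Lemma eq_divf_cross (E : fieldType) (a b c d : E) : b != 0 -> d != 0 ->
  a / b = c / d -> a * d = c * b.
Proof. by move=> b0 d0 /eqP; rewrite eqr_div // => /eqP. Qed.

(** The case of [valuation_of_subring] in which every element is, up to a unit,
    a power of [T]. *)
Lemma valuation_of_uniformizer (E : fieldType) (A : set E) (T : E) :
  subring A -> T != 0 -> A T -> ~ A T^-1 ->
  (forall z : E, z != 0 -> exists m : int, unit_in A (z / T ^ m)) ->
  exists v, [/\ normalized_valuation v, v T = 1 &
    forall a : E, a != 0 -> (0 <= v a <-> A a)].
Proof.
move=> hA T0 AT nT ex.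
have decomp z : z != 0 -> exists (m : int) u, unit_in A u /\ z = T ^ m * u.
  move=> z0; have [m hm] := ex z z0; exists m, (z / T ^ m); split=> //.
  by rewrite mulrC divfK // expfz_neq0.
have vA : valuation_subring A.
  split=> // z /decomp[m [u [[u0 Au Au'] ->]]].
  have [m0|/ltW m0] := leP 0 m; [left | right].
    by apply: (subringM hA) => //; exact: subring_expz.
  rewrite invfM invr_expz; apply: (subringM hA) => //.
  by apply: subring_expz => //; rewrite oppr_ge0.
have ex1 z : z != 0 -> exists m : int, unit_in A (z ^+ 1 / T ^ m) by exact: ex.
have [v [hv vP]] := valuation_of_subring vA (ltnSn 0) T0 AT nT ex1.
exists v; split=> //; have [a a0 va] := valuation_surj hv 1.
have [m [u [[u0 Au Au'] ea]]] := decomp a a0.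
have vu : v u = 0.
  have /(vP _ u0) := Au; have u0' : u^-1 != 0 by rewrite invr_eq0.
  have /(vP _ u0') := Au'; rewrite (valuationV hv); intros_lia.
have /(vP _ T0) vT := AT.
move: va; rewrite ea (valuationM hv) ?expfz_neq0 // (valuationXz hv) vu addr0.
by move=> e; exact: mulz_eq1_ge0 e vT.
Qed.

Section RationalFunctions.

Variable F : fieldType.
Implicit Types (f g Q : {poly F}) (z : ratfun F).

Lemma ratfunP z : exists f g, g != 0 /\ z = f%:F / g%:F.
Proof.
elim/quotW: z => x; exists (frac x).1, (frac x).2.
have d0 := denom_ratioP x; split=> //.
have dF0 : (frac x).2%:F != 0 :> ratfun F by rewrite tofrac_eq0.
apply: (mulfI dF0); rewrite mulrCA divff // mulr1.
change (FracField.mul (frac x).2%:F (\pi x)%qT = (frac x).1%:F).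
rewrite !piE; apply/eqmodP; rewrite /= FracField.equivfE /FracField.mulf.
by rewrite !numden_Ratio ?mul1r ?mulr1 ?oner_neq0 // mulrC.
Qed.

Lemma tofrac_inj : injective (@FracField.tofrac {poly F}).
Proof. by move=> f g /eqP; rewrite tofrac_eq => /eqP. Qed.

Lemma irreducible_dvdM Q f g : irreducible_poly Q ->
  ~~ (Q %| f) -> ~~ (Q %| g) -> ~~ (Q %| f * g).
Proof.
by move=> irr nf ng; rewrite Gauss_dvdpr // irreducible_poly_coprime.
Qed.

Lemma size_cofactor_lt Q f : (1 < size Q)%N -> f != 0 ->
  (size f < size (f * Q)%R)%N.
Proof.
move=> sQ f0; have Q0 : Q != 0 by rewrite -size_poly_gt0 (leq_trans _ sQ).
rewrite size_mul //; move: (size f) (size Q) sQ => a b; intros_lia.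
Qed.

Lemma factor_out Q f : (1 < size Q)%N -> f != 0 ->
  exists k f', f = Q ^+ k * f' /\ ~~ (Q %| f').
Proof.
move=> sQ; have [n] := ubnP (size f); elim: n f => // n IH f sf f0.
have [|nd] := boolP (Q %| f); last by exists 0%N, f; rewrite expr0 mul1r.
move=> /dvdpP[f1 ef]; have f10 : f1 != 0.
  by apply: contraNneq f0 => e; rewrite ef e mul0r.
have Q0 : Q != 0 by rewrite -size_poly_gt0 (leq_trans _ sQ).
have [|k [f' [e nd]]] := IH f1 _ f10.
  by rewrite -ltnS (leq_trans _ sf) // ltnS ef size_cofactor_lt.
by exists k.+1, f'; rewrite ef {1}e exprS [Q * _]mulrC mulrAC.
Qed.

Lemma exists_irreducible f : (1 < size f)%N ->
  exists2 Q, irreducible_poly Q & Q %| f.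
Proof.
have [n] := ubnP (size f); elim: n f => // n IH f sn sf.
have [irr|nirr] := pselect (irreducible_poly f); first by exists f.
have [q [sq qf nqf]] : exists q : {poly F}, [/\ size q != 1%N, q %| f & ~~ (q %= f)].
  apply: contrapT => none; apply: nirr; split=> // q sq qf.
  by apply: contrapT => /negP nqf; apply: none; exists q.
have f0 : f != 0 by rewrite -size_poly_gt0 (leq_trans _ sf).
have q0 : q != 0 by apply: contraTneq qf => ->; rewrite dvd0p.
have lt : (size q < size f)%N.
  by rewrite ltn_neqAle dvdp_leq // andbT dvdp_size_eqp.
have [||Q irr Qq] := IH q; first by lia.
  by move: sq q0; rewrite -size_poly_gt0; case: (size q) => [|[]].
by exists Q => //; exact: dvdp_trans Qq qf.
Qed.

(** This characterizes the [Q]-adic valuation, since every rational function is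
    a quotient of polynomials. *)
Definition adic_valuation Q (v : ratfun F -> int) : Prop :=
  normalized_valuation v /\
  forall f (k : nat), f != 0 -> (k%:Z <= v f%:F) = (Q ^+ k %| f).

(** The valuation ring is the localization at [Q], and [Q] generates its
    maximal ideal. *)
Lemma exists_adic_valuation Q : irreducible_poly Q ->
  exists v, adic_valuation Q v.
Proof.
move=> irr; have sQ := irr.1; have Q0 := irredp_neq0 irr.
have F0 f : (f%:F == 0 :> ratfun F) = (f == 0) by rewrite tofrac_eq0.
have nd0 g : ~~ (Q %| g) -> g != 0 by apply: contraNneq => ->; rewrite dvdp0.
pose A : set (ratfun F) :=
  [set z | exists f g, ~~ (Q %| g) /\ z = f%:F / g%:F]%classic.
have nd1 : ~~ (Q %| 1) by rewrite dvdp1; move: sQ; case: (size Q) => [|[]].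
have hA : subring A.
  split.
  - by exists 1, 1; rewrite divr1.
  - move=> _ _ [f [g [ng ->]]] [f' [g' [ng' ->]]].
    exists (f * g' - f' * g), (g * g'); split; first exact: irreducible_dvdM.
    by rewrite tofracB !tofracM subf_div // F0 nd0.
  - move=> _ _ [f [g [ng ->]]] [f' [g' [ng' ->]]].
    exists (f * f'), (g * g'); split; first exact: irreducible_dvdM.
    by rewrite !tofracM invfM mulrACA.
have T0 : Q%:F != 0 :> ratfun F by rewrite F0.
have decomp z : z != 0 -> exists m : int, unit_in A (z / Q%:F ^ m).
  move=> z0; have [f [g [g0 ez]]] := ratfunP z.
  have f0 : f != 0 by apply: contraNneq z0 => e; rewrite ez e rmorph0 mul0r.
  have [a [f' [ef nf]]] := factor_out sQ f0.
  have [b [g' [eg ng]]] := factor_out sQ g0.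
  exists (a%:Z - b%:Z); have -> : z / Q%:F ^ (a%:Z - b%:Z) = f'%:F / g'%:F.
    by rewrite ez ef eg !tofracM 2!tofracXn (divf_expz _ _ _ _ T0).
  split; first by apply: divf_neq0; rewrite F0 nd0.
    by exists f', g'.
  by exists g', f'; rewrite invf_div.
have AT : A Q%:F by exists Q, 1; rewrite rmorph1 divr1.
have nT : ~ A Q%:F^-1.
  move=> [f [g [ng e]]]; case/negP: (ng); apply/dvdpP; exists f.
  have g0 : g%:F != 0 :> ratfun F by rewrite F0 nd0.
  have e1 : 1 / Q%:F = f%:F / g%:F :> ratfun F by rewrite div1r.
  apply: tofrac_inj; rewrite tofracM -(eq_divf_cross T0 g0 e1).
  exact/esym/mul1r.
have [v [hv vQ vP]] := valuation_of_uniformizer hA T0 AT nT decomp.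
exists v; split=> // f k f0; have f0' : f%:F != 0 :> ratfun F by rewrite F0.
have Qk0 := expf_neq0 k T0.
have z0 := divf_neq0 f0' Qk0.
have -> : (k%:Z <= v f%:F) = (0 <= v (f%:F / Q%:F ^+ k)).
  rewrite (valuationM hv f0' (invr_neq0 Qk0)) (valuationV hv) (valuationX hv) vQ.
  by rewrite mulr1 subr_ge0.
apply/idP/idP => [/(vP _ z0) [a [g [ng e]]]|/dvdpP[a ef]]; last first.
  apply/(vP _ z0); exists a, 1; split=> //.
  by rewrite ef tofracM tofracXn (mulfK Qk0) tofrac1 divr1.
rewrite -(@Gauss_dvdpl _ f g) ?coprimep_expl ?irreducible_poly_coprime //.
apply/dvdpP; exists a; apply: tofrac_inj; rewrite !tofracM tofracXn.
have g0 : g%:F != 0 :> ratfun F by rewrite F0 nd0.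
exact: eq_divf_cross Qk0 g0 e.
Qed.

(** A common irreducible factor of numerator and denominator can be cancelled,
    and one of the denominator alone would be a pole. *)
Lemma ratfun_polynomial z :
  (forall Q v, irreducible_poly Q -> adic_valuation Q v -> 0 <= v z) ->
  exists f, z = f%:F.
Proof.
have [f [g]] := ratfunP z; have [n] := ubnP (size g).
elim: n f g => // n IH f g sn [g0 ez] pos.
have [sg|sg] := leqP (size g) 1.
  have /size1_polyC eg := sg; have c0 : g`_0 != 0 by rewrite -polyC_eq0 -eg.
  have g0' : g%:F != 0 :> ratfun F by rewrite tofrac_eq0.
  exists ((g`_0)^-1 *: f); rewrite ez; apply: (canLR (mulfK g0')); rewrite -tofracM.
  by rewrite {2}eg mulrC mul_polyC scalerA divff // scale1r.
have [f0|f0] := eqVneq f 0; first by exists 0; rewrite ez f0 rmorph0 mul0r.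
have [Q irr Qg] := exists_irreducible sg; have [v av] := exists_adic_valuation irr.
have [hv vP] := av; have F0 h : h != 0 -> h%:F != 0 :> ratfun F by rewrite tofrac_eq0.
have Qf : Q %| f.
  have vg : 1%:Z <= v g%:F by rewrite vP // expr1.
  suff : 1%:Z <= v f%:F by rewrite vP // expr1.
  have := pos Q v irr av.
  rewrite ez (valuationM hv (F0 _ f0) (invr_neq0 (F0 _ g0))) (valuationV hv) subr_ge0.
  exact: le_trans.
case/dvdpP: Qg => g' eg; case/dvdpP: Qf => f' ef.
have Q0 := irredp_neq0 irr.
have g'0 : g' != 0 by apply: contraNneq g0 => e; rewrite eg e mul0r.
apply: (IH f' g') => //.
  by rewrite -ltnS (leq_trans _ sn) // ltnS eg size_cofactor_lt // irr.1.
split=> //; rewrite ez ef eg !tofracM -mulf_div (divff (F0 _ Q0)).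
exact: mulr1.
Qed.

Lemma adic_valuation_ge0 Q v f : adic_valuation Q v -> f != 0 -> 0 <= v f%:F.
Proof. by move=> [_ vP] f0; rewrite (vP f 0%N) // expr0 dvd1p. Qed.

(** If [Q] divides [f] then [Q ^ p] does, since [p] divides a positive value;
    induction on the size removes one such factor at a time. *)
Lemma polynomial_power (p : nat) f : (0 < p)%N -> f != 0 ->
  (forall Q v, irreducible_poly Q -> adic_valuation Q v -> (p%:Z %| v f%:F)%Z) ->
  exists c g, c != 0 /\ f = c *: g ^+ p.
Proof.
move=> p0; have [n] := ubnP (size f); elim: n f => // n IH f sn f0 hp.
have [sf|sf] := leqP (size f) 1.
  have /size1_polyC ef := sf; exists f`_0, 1; rewrite -polyC_eq0 -ef.
  by rewrite expr1n alg_polyC.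
have [Q irr Qf] := exists_irreducible sf; have [v av] := exists_adic_valuation irr.
have [hv vP] := av; have F0 h : h != 0 -> h%:F != 0 :> ratfun F by rewrite tofrac_eq0.
have Q0 := irredp_neq0 irr; have Qp0 : Q ^+ p != 0 by rewrite expf_neq0.
have : Q ^+ p %| f.
  have v1 : 1%:Z <= v f%:F by rewrite vP // expr1.
  have /dvdzP[q eq] := hp Q v irr av.
  rewrite eq in v1; rewrite -vP // eq ler_peMl //.
  have : 0 < q by rewrite -(@pmulr_lgt0 _ p%:Z) //; exact: lt_le_trans v1.
  by clear; intros_lia.
case/dvdpP => f' ef.
have f'0 : f' != 0 by apply: contraNneq f0 => e; rewrite ef e mul0r.
have [||c [g [c0 eg]]] := IH f' _ f'0.
- have sQp : (1 < size (Q ^+ p))%N.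
    rewrite -(prednK p0) exprSr (leq_ltn_trans _ (size_cofactor_lt irr.1 _)) //;
    by rewrite ?size_poly_gt0 expf_neq0.
  by rewrite -ltnS (leq_trans _ sn) // ltnS ef size_cofactor_lt.
- move=> Q' v' irr' av'; have := hp Q' v' irr' av'.
  rewrite ef tofracM tofracXn (valuationM av'.1 (F0 _ f'0) (expf_neq0 _ (F0 _ Q0))).
  by rewrite (valuationX av'.1) rpredDr ?dvdz_mulr.
by exists c, (g * Q); rewrite ef eg exprMn scalerAl.
Qed.

End RationalFunctions.

(** * Torsion in the divisor class group *)

(** The representatives [r] of the classes of [G] modulo [H] carry the group law
    of the quotient, to which Cauchy's theorem for finite groups applies. *)
Lemma cauchy_quotient (V : zmodType) (G H : set V) (h p : nat) (r : 'I_h -> V) :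
  G 0 -> (forall x y, G x -> G y -> G (x - y)) ->
  H 0 -> (forall x y, H x -> H y -> H (x - y)) ->
  (forall i, G (r i)) -> (forall x, G x -> exists i, H (x - r i)) ->
  (forall i j, H (r i - r j) -> i = j) ->
  prime p -> (p %| h)%N ->
  exists x, [/\ G x, ~ H x & H (x *+ p)].
Proof.
move=> G0 GB H0 HB Gr ex inj pp ph.
have GN x : G x -> G (- x) by rewrite -sub0r; exact: GB.
have GD x y : G x -> G y -> G (x + y) by rewrite -{2}[y]opprK => Gx /GN; exact: GB.
have HN x : H x -> H (- x) by rewrite -sub0r; exact: HB.
have HD x y : H x -> H y -> H (x + y) by rewrite -{2}[y]opprK => Hx /HN; exact: HB.
have ex' x : exists i, G x -> H (x - r i).
  have [/ex[i]|nG] := pselect (G x); first by exists i.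
  by have [i _] := ex 0 G0; exists i.
have [cl hcl] := choice ex'.
have clE x y : G x -> G y -> H (x - y) -> cl x = cl y.
  move=> Gx Gy Hxy; apply: inj.
  have -> : r (cl x) - r (cl y) = - (x - r (cl x)) + (x - y) + (y - r (cl y)).
    by rewrite opprB !addrA !subrK.
  by apply: (HD) (hcl _ Gy); apply: HD => //; apply/HN/hcl.
have clK i : cl (r i) = i by apply/esym/inj/hcl.
pose op i j := cl (r i + r j); pose one := cl 0; pose inv i := cl (- r i).
have opA : associative op.
  move=> i j k; apply: clE; [exact: GD | exact: GD |].
  have -> : r i + r (op j k) - (r (op i j) + r k) =
      (r i + r j - r (op i j)) - (r j + r k - r (op j k)).
    rewrite opprB !opprD !addrA (addrAC _ (r (op j k)) (- r j)).
    by rewrite (addrAC _ _ (- r j)) addrK (addrAC (r i) (r (op j k))).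
  by apply: HB; apply: hcl; exact: GD.
have op1 : left_id one op.
  move=> i; rewrite -[RHS]clK; apply: clE; [exact: GD | exact: Gr |].
  by rewrite addrK -[r _]opprK; apply: HN; rewrite -sub0r; exact: hcl.
have opV : left_inverse one inv op.
  move=> i; apply: clE; [exact: GD | exact: G0 |].
  rewrite subr0 -[_ + _]opprK opprD; apply: HN; rewrite addrC.
  by apply: hcl; exact: GN.
pose gT : finGroupType := HB.pack 'I_h (Finite_isGroup.Build 'I_h opA op1 opV).
have [|x _ ox] := @Cauchy gT p [set: gT]%G pp; first by rewrite cardsT card_ord.
have rX n : H (r (x ^+ n)%g - r x *+ n).
  elim: n => [|n IH].
    rewrite expg0 mulr0n subr0 -[r _]opprK; apply: HN; rewrite -sub0r; exact: hcl.
  rewrite expgS mulrS.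
  have -> : r (x * x ^+ n)%g - (r x + r x *+ n) =
    - (r x + r (x ^+ n)%g - r (op x (x ^+ n)%g)) + (r (x ^+ n)%g - r x *+ n).
    by rewrite opprB !opprD !addrA subrK.
  by apply: HD => //; apply/HN/hcl/GD.
have r1 : H (r one) by rewrite -[r _]opprK; apply: HN; rewrite -sub0r; exact: hcl.
exists (r x); split=> //.
  move=> Hrx; have x1 : x = one by apply: inj; exact: HB.
  have : #[x]%g = 1%N by rewrite x1; exact: order1.
  by move=> e; move: pp; rewrite -ox e.
have -> : r x *+ p = r (x ^+ p)%g - (r (x ^+ p)%g - r x *+ p) by rewrite opprB addrC subrK.
by apply: HB => //; rewrite -ox expg_order.
Qed.

(** * Function fields *)

Section FunctionFields.

Variables (F : finFieldType) (L : fieldExtType (ratfun F)).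

Lemma const_inV (c : F) : const_in L c^-1 = (const_in L c)^-1.
Proof.
have [->|c0] := eqVneq c 0.
  by rewrite /const_in /poly_in invr0 !rmorph0 scale0r invr0.
have e : const_in L c * const_in L c^-1 = 1.
  rewrite /const_in /poly_in mulr_algl scalerA -tofracM -polyCM divff //.
  by rewrite !rmorph1 scale1r.
have nz : const_in L c != 0.
  by apply: contraTneq (oner_neq0 L) => z; rewrite -e z mul0r eqxx.
by apply: (mulfI nz); rewrite e divff.
Qed.

(** A nonzero constant and its inverse both have value [0] at [Q], so their
    values at [w] are both nonnegative, hence zero. *)
Lemma exists_place (Q : {poly F}) v (w : L -> int) :
  adic_valuation Q v -> normalized_valuation w -> lies_above v w ->
  exists P : place L, ord P = w.
Proof.
move=> av hw ab; have ge0 c : c != 0 -> 0 <= w (const_in L c).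
  by move=> c0; apply: ab; rewrite (adic_valuation_ge0 av) // polyC_eq0.
have wc c : c != 0 -> w (const_in L c) = 0.
  move=> c0; have := ge0 c^-1; rewrite invr_eq0 const_inV (valuationV hw) => /(_ c0).
  by have := ge0 c c0; intros_lia.
by exists (Place (valuation0 hw) (valuationM hw) (valuationD hw) wc (valuation_surj hw)).
Qed.

Lemma poly_in_eq0 (f : {poly F}) : (poly_in L f == 0) = (f == 0).
Proof. by rewrite scalar_eq0 tofrac_eq0. Qed.

Lemma poly_in1 : poly_in L 1 = 1.
Proof. by rewrite /poly_in tofrac1 scale1r. Qed.

Lemma poly_inM (f g : {poly F}) : poly_in L (f * g) = poly_in L f * poly_in L g.
Proof. by rewrite /poly_in tofracM mulr_algl scalerA. Qed.

Lemma poly_inX (f : {poly F}) n : poly_in L (f ^+ n) = poly_in L f ^+ n.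
Proof.
by elim: n => [|n IH]; rewrite ?poly_in1 // !exprS poly_inM IH.
Qed.

(** The map [poly_in], in a form to which results on ring morphisms apply. *)
Definition poly_emb : {rmorphism {poly F} -> L} :=
  in_alg L \o @FracField.tofrac {poly F}.

Lemma integral_closure_poly (f : {poly F}) : integral_closure (poly_in L f).
Proof. exact: (integral_id poly_emb). Qed.

Lemma integral_closureM (a b : L) :
  integral_closure a -> integral_closure b -> integral_closure (a * b).
Proof. exact: (integral_mul (RtoK := poly_emb)). Qed.

Lemma integral_equation (a : L) : integral_closure a ->
  exists k (r : nat -> {poly F}), a ^+ k = \sum_(i < k) ((r i)%:F)%:A * a ^+ i.
Proof.
move=> [m mon]; rewrite /root /map_poly horner_poly.
have sm : size m = (size m).-1.+1.
  by rewrite prednK // size_poly_gt0 monic_neq0.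
rewrite sm big_ord_recr /= -lead_coefE (eqP mon) poly_in1 mul1r.
rewrite addrC addr_eq0 => /eqP e; exists (size m).-1, (fun i => - m`_i).
rewrite e -sumrN; apply: eq_bigr => i _.
by rewrite tofracN scaleNr mulNr.
Qed.

(** The norm has nonnegative value at every irreducible [Q], as [a] is integral,
    and this value is a multiple of [p] by [dvd_val_norm]. *)
Lemma field_norm_power (p : nat) (a : L) : (0 < p)%N -> a != 0 ->
  integral_closure a -> (forall P : place L, (p%:Z %| ord P a)%Z) ->
  exists (c : F) (g : {poly F}), c != 0 /\ field_norm a = (c *: g ^+ p)%:F.
Proof.
move=> p0 a0 /integral_equation[k [r er]] hP.
have na0 : norm a != 0 by exact: norm_neq0.
have [f ef] : exists f, norm a = f%:F.
  apply: ratfun_polynomial => Q v irr av.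
  apply: (norm_integral (r := fun i => (r i)%:F) av.1 a0 _ er) => i; rewrite /val_ge.
  have [->|r0] := eqVneq (r i) 0; first by rewrite tofrac0 eqxx.
  by rewrite (adic_valuation_ge0 av r0) orbT.
have f0 : f != 0 by rewrite -tofrac_eq0 -ef.
have [|c [g [c0 eg]]] := polynomial_power p0 f0.
  move=> Q v irr av; rewrite -ef; apply: (dvd_val_norm av.1 a0) => w hw ab.
  by have [P eP] := exists_place av hw ab; rewrite -eP.
by exists c, g; split=> //; rewrite -eg -ef.
Qed.

Lemma common_denominator (n : nat) (c : nat -> ratfun F) :
  exists2 D : {poly F}, D != 0 &
    forall i, (i < n)%N -> exists f, D%:F * c i = f%:F.
Proof.
elim: n => [|n [D D0 IH]]; first by exists 1; rewrite ?oner_neq0.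
have [f [g [g0 ec]]] := ratfunP (c n).
have gF0 : g%:F != 0 :> ratfun F by rewrite tofrac_eq0.
exists (D * g); first by rewrite mulf_neq0.
move=> i; rewrite ltnS leq_eqVlt => /orP[/eqP->|/IH[f' ef']].
  exists (D * f); rewrite ec !tofracM -mulrA; congr (_ * _).
  by rewrite mulrC (divfK gF0).
by exists (f' * g); rewrite !tofracM -ef' mulrAC.
Qed.

(** The coefficients of the minimal polynomial of [a] have a common denominator
    [D], and [D * a] satisfies the equation with its roots scaled by [D]. *)
Lemma clear_denominator (a : L) :
  exists2 D : {poly F}, D != 0 & integral_closure (poly_in L D * a).
Proof.
set k := adjoin_degree 1%AS a.
have [c qc] := base_polyP (minPolyOver 1%AS a).
have sz := size_minPoly 1%AS a; rewrite -/k in sz.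
have ck : c k = 1.
  have := monic_minPoly 1%AS a; rewrite monicE lead_coefE sz /= qc.
  by rewrite -subr_eq0 -{2}(scale1r 1) -scalerBl scalar_eq0 subr_eq0 => /eqP.
have := root_minPoly 1%AS a; rewrite /root horner_coef sz => /eqP sum0.
have [D D0 hD] := common_denominator k c; exists D => //.
pose m i := (D%:F ^+ (k - i) * c i)%:A : L.
have mk : m k = 1 by rewrite /m subnn expr0 mul1r ck scale1r.
pose q := \poly_(i < k.+1) m i.
have lq : lead_coef q = 1 by rewrite /q lead_coef_poly //= mk ?oner_eq0.
have int i : integralOver poly_emb q`_i.
  rewrite coef_poly; case: ifP => [|_]; last exact: integral0.
  rewrite ltnS leq_eqVlt => /orP[/eqP->|ik]; first by rewrite mk; exact: integral1.
  have [f ef] := hD i ik.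
  have -> : m i = poly_emb (D ^+ (k - i).-1 * f).
    rewrite /m -[(k - i)%N in LHS]prednK ?subn_gt0 // exprSr -mulrA ef /=.
    by rewrite tofracM tofracXn.
  exact: integral_id.
suff : integralOver poly_emb (poly_in L D * a) by [].
apply: (integral_root_monic (p := q)); first by rewrite monicE lq.
  rewrite /root horner_poly.
  rewrite (eq_bigr (fun i : 'I_k.+1 => poly_in L D ^+ k * ((minPoly 1%AS a)`_i * a ^+ i))).
    by rewrite -mulr_sumr sum0 mulr0.
  move=> i _; rewrite qc exprMn /m -!in_algE rmorphM rmorphXn /=.
  rewrite -[X in _ = poly_in L D ^+ X * _](@subnK i); last by rewrite -ltnS.
  by rewrite exprD -!mulrA; congr (_ * _); rewrite mulrCA.
by apply/integral_poly.
Qed.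

Section Divisors.

Lemma divisors0_zero : divisors0 (0 : place L -> int).
Proof.
split.
  rewrite /is_divisor (_ : [set P | _]%classic = set0) //.
  by apply/seteqP; split => P //=; rewrite eqxx.
by rewrite /divisor_degree fsbig1 // => P _; rewrite mul0r.
Qed.

Lemma divisor_degree_on (S : set (place L)) (D : place L -> int) :
  (forall P, D P != 0 -> S P) ->
  divisor_degree D = \sum_(P \in S) D P * (place_degree P)%:Z.
Proof.
move=> DS; apply/esym/fsbig_widen => // P [_ nSP] /=.
by have [->|/DS//] := eqVneq (D P) 0; rewrite mul0r.
Qed.

Lemma divisors0B (D E : place L -> int) :
  divisors0 D -> divisors0 E -> divisors0 (D - E).
Proof.
move=> [fD dD] [fE dE]; have [DS ES DES] : [/\
    forall P, D P != 0 -> ([set P | D P != 0] `|` [set P | E P != 0])%classic P,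
    forall P, E P != 0 -> ([set P | D P != 0] `|` [set P | E P != 0])%classic P &
    forall P, (D - E) P != 0 -> ([set P | D P != 0] `|` [set P | E P != 0])%classic P].
  split=> P /=; [by left | by right | rewrite -[(D - E) P]/(D P - E P)].
  by have [->|] := eqVneq (D P) 0; [rewrite sub0r oppr_eq0; right | left].
have fS : finite_set ([set P | D P != 0] `|` [set P | E P != 0])%classic.
  by rewrite finite_setU.
split; first exact: sub_finite_set fS.
rewrite (divisor_degree_on DES).
rewrite (eq_fsbigr (fun P => D P * (place_degree P)%:Z +
    (-1) * (E P * (place_degree P)%:Z))); last first.
  by move=> P _; rewrite mulN1r -mulNr -mulrDl.
rewrite fsbig_split // -mulr_fsumr -(divisor_degree_on DS) -(divisor_degree_on ES).
by rewrite dD dE mulr0.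
Qed.

Lemma place_valuation (P : place L) : normalized_valuation (ord P).
Proof. by split; [exact: Defs.ord0 | exact: ordM | exact: ordD | exact: ord_surj]. Qed.

Lemma principal0 : is_principal (0 : place L -> int).
Proof.
by exists 1; rewrite ?oner_neq0 // => P; rewrite (valuation1 (place_valuation P)).
Qed.

Lemma principalB (D E : place L -> int) :
  is_principal D -> is_principal E -> is_principal (D - E).
Proof.
move=> [a a0 Da] [b b0 Eb]; exists (a / b); first exact: divf_neq0.
move=> P; rewrite (ordM P a0 (invr_neq0 b0)) (valuationV (place_valuation P)).
by rewrite -Da -Eb.
Qed.

Lemma divisor_class_eq (D E : place L -> int) : divisors0 D ->
  (divisor_class D = divisor_class E <-> is_principal (D - E)).
Proof.
move=> D0; split=> [e|DE].
  have : divisor_class D D by split=> //; rewrite -[_ \- _]/(D - D) subrr; exact: principal0.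
  by rewrite e => -[].
apply/seteqP; split=> X [X0 XD]; split=> //.
  have -> : X \- E = (X - D) - (0 - (D - E)).
    by rewrite sub0r opprK addrA subrK.
  by apply: principalB => //; apply: principalB => //; exact: principal0.
have -> : X \- D = (X - E) - (D - E) by rewrite opprB addrA subrK.
exact: principalB.
Qed.

(** The class number counts classes of divisors, and such a class consists of
    the degree zero divisors equivalent to a given one, so choosing a divisor in
    each class presents the class group in the form of [cauchy_quotient]. *)
Lemma exists_torsion_divisor (h p : nat) : is_class_number L h -> prime p ->
  (p %| h)%N ->
  exists D : place L -> int, ~ is_principal D /\ is_principal (D *+ p).
Proof.
move=> /card_set_bijP[f [ffun finj fsurj]] pp ph.
have ex (i : 'I_h) : exists D : place L -> int,
    divisors0 D /\ f (divisor_class D) = i.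
  have [X [D D0 <-] fX] := fsurj i (ltn_ord i).
  by exists D.
have [r hr] := choice ex.
have cg (D : place L -> int) : divisors0 D -> class_group0 (divisor_class D).
  by move=> D0; exists D.
have [|i j|D [_]] := @cauchy_quotient _ (@divisors0 F L) (@is_principal F L) h p r
    divisors0_zero divisors0B principal0 principalB (fun i => (hr i).1) _ _ pp ph.
- move=> D D0; have lt := ffun _ (cg D D0).
  exists (Ordinal lt); apply/divisor_class_eq => //.
  apply: finj; rewrite ?inE; [exact: cg | exact: cg (hr _).1 | by rewrite (hr _).2].
- move=> /(divisor_class_eq _ (hr i).1) e; apply: ord_inj.
  by rewrite -(hr i).2 -(hr j).2 e.
by exists D.
Qed.

End Divisors.

End FunctionFields.

Theorem corollary4p6 (F : finFieldType) (L : fieldExtType (ratfun F))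
    (A B : {poly F}) (y : L) (hstd : standard_form A B y)
    (h : nat) (hh : is_class_number L h)
    (p : nat) (hp : prime p) (hph : (p %| h)%N) :
  exists a : L,
    [/\ integral_closure a,
        (forall b : L, a <> b ^+ p) &
        exists (c : F) (g : {poly F}),
          c != 0 /\ field_norm a = (c *: g ^+ p)%:F].
Proof.
have [D [nD [a a0 Da]]] := exists_torsion_divisor hh hp hph.
have [f f0 fa] := clear_denominator a.
have p0 := prime_gt0 hp; have f0' : poly_in L f != 0 by rewrite poly_in_eq0.
have fp0 : poly_in L f ^+ p != 0 by rewrite expf_neq0.
have ordp P : ord P a = p%:Z * D P by rewrite -Da natmulfctE -mulr_natl natz.
have fpa0 : poly_in L f ^+ p * a != 0 by rewrite mulf_neq0.
have int : integral_closure (poly_in L f ^+ p * a).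
  rewrite -(prednK p0) exprSr -mulrA; apply: integral_closureM => //.
  by rewrite -poly_inX; exact: integral_closure_poly.
exists (poly_in L f ^+ p * a); split=> //.
- (* if it is the [p]-th power of [b], then [D] is the divisor of [b / f] *)
  move=> b eb; apply: nD; have b0 : b != 0.
    by move: fpa0; rewrite eb expf_eq0 p0.
  exists (b / poly_in L f); first exact: divf_neq0.
  move=> P; have hP := place_valuation P.
  have : ord P (poly_in L f ^+ p * a) = ord P (b ^+ p) by rewrite eb.
  rewrite (ordM P fp0 a0) (ordM P b0 (invr_neq0 f0')) !(valuationX hP) (valuationV hP).
  rewrite ordp -mulrDr => e; apply/eqP; rewrite eq_sym subr_eq addrC; apply/eqP.
  by apply: (mulfI _ (esym e)); rewrite eqz_nat -lt0n.
apply: field_norm_power => // P.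
rewrite (ordM P fp0 a0) ordp (valuationX (place_valuation P)).
by rewrite -mulrDr dvdz_mulr.
Qed.
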